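(* Let $f:\mathbb{R}\to\mathbb{R}^+$ be a function with $\lim_{T\to\infty}f(T)=\infty$, and let $\Gamma$ be a group. Given two comparable actions of $\Gamma$, each non-elementary or quasi-parabolic, on two nontrivial Gromov hyperbolic spaces $(X,d)$ and $(Y,d')$, for any point $\xi\in\Lambda_X\Gamma$ there exists a subset $E\subset\Gamma$ such that if $\ell_d(\gamma)=\ell_{d'}(\gamma)$ for all $\gamma\in E$, then $\ell_d=\ell_{d'}$ on $\Gamma$. Furthermore, $E$ can be chosen such that: (1) the growth of $E$ with respect to $d$ (and/or with respect to $d'$) satisfies $$\#\{\gamma\in E\mid \ell_d(\gamma)\le T\}\le f(T)$$ for all $T$ (respectively the same with $\ell_{d'}$ in place of $\ell_d$); (2) the only accumulation point of $E$ on $\partial X$ is $\xi$; (3) if furthermore the action on $X$ is proper, $E$ can be chosen to contain only primitive elements.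
   Context: For a metric space $(X,d)$ and $o\in X$, the Gromov product is $\langle p,q\rangle_o=\frac12(d(p,o)+d(q,o)-d(p,q))$. $(X,d)$ is $\delta$-Gromov hyperbolic if $\langle p,q\rangle_o\ge\min\{\langle p,r\rangle_o,\langle r,q\rangle_o\}-\delta$ for all $o,p,q,r\in X$, and Gromov hyperbolic if this holds for some $\delta>0$. The Gromov boundary $\partial X$ is the set of equivalence classes of sequences $(x_n)$ in $X$ with $\langle x_i,x_j\rangle_o\to\infty$, where $(x_n)\sim(y_n)$ if $\langle x_i,y_j\rangle_o\to\infty$; it carries its usual topology. $X$ is nontrivial if $\partial X$ contains at least 3 points. All actions are by isometries. The limit set $\Lambda_X\Gamma$ is $\overline{\Gamma\cdot o}\cap\partial X$ (independent of $o$). An accumulation point of a subset $E\subset\Gamma$ on $\partial X$ is an accumulation point in $\partial X$ of the set $E\cdot o$. A hyperbolic element is one with positive translation length; it has exactly two fixed points in $\partial X$. In the sense of Gromov's classification, an action is non-elementary if $\Gamma$ contains two hyperbolic elements with disjoint pairs of fixed points in $\partial X$, and quasi-parabolic if $\Gamma$ contains hyperbolic elements and has exactly one global fixed point in $\partial X$, with limit set having more than two points. Two such actions on $X$ and $Y$ are comparable if there is a $\Gamma$-equivariant homeomorphism $\Lambda_X\Gamma\to\Lambda_Y\Gamma$. The action on $X$ is proper if for every $R>0$ and $o\in X$ only finitely many $\gamma\in\Gamma$ satisfy $d(\gamma o,o)\le R$. The translation length is $\ell_d(\gamma)=\lim_{n\to\infty}\frac{d(\gamma^n o,o)}{n}$.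 An element $\gamma\in\Gamma$ is primitive if $\gamma\ne\eta^n$ for every $\eta\in\Gamma$ and every integer $n$ with $|n|>1$. *)

(* Defs.v *)
From HB Require Import structures.
From mathcomp Require Import all_boot all_order all_algebra.
From mathcomp Require Import all_classical all_reals all_analysis.

Set Implicit Arguments.
Unset Strict Implicit.
Unset Printing Implicit Defensive.

Import Order.TTheory GRing.Theory Num.Theory.
Import numFieldNormedType.Exports.

Local Open Scope classical_set_scope.
Local Open Scope ring_scope.

Definition three_points (T : Type) (A : set T) : Prop :=
  exists x y z, [/\ A x, A y & A z] /\ [/\ x <> y, y <> z & x <> z].

Section GromovBoundary.
Context {R : realType} (X : metricType R).
Implicit Types (o p q r : X) (x y : nat -> X).

Definition gromov_product o p q : R :=
  (mdist p o + mdist q o - mdist p q) / 2.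

Definition gromov_hyperbolic : Prop :=
  exists delta : R, 0 < delta /\ forall o p q r,
    Num.min (gromov_product o p r) (gromov_product o r q) - delta
      <= gromov_product o p q.

(* The choice of the base point [o] is immaterial: changing it alters Gromov
   products by a bounded amount.  For hyperbolic [X] the same holds for
   all the definitions below that quantify over base points. *)
Definition product_to_infty x y : Prop :=
  forall o, gromov_product o (x ij.1) (y ij.2) @[ij --> (\oo, \oo)] --> +oo.

Definition gromov_sequence x : Prop := product_to_infty x x.

Definition gromov_class x : set (nat -> X) :=
  [set y | gromov_sequence y /\ product_to_infty x y].

(* A point of the Gromov boundary is the set of all its representing
   sequences; these sets are equivalence classes when [X] is hyperbolic. *)
Definition gboundary : Type :=
  {xi : set (nat -> X) | exists2 x, gromov_sequence x & xi = gromov_class x}.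

HB.instance Definition _ := gen_eqMixin gboundary.
HB.instance Definition _ := gen_choiceMixin gboundary.

Definition bordification : Type := (X + gboundary)%type.

HB.instance Definition _ := gen_eqMixin bordification.
HB.instance Definition _ := gen_choiceMixin bordification.

Definition inner (p : X) : bordification := inl p.
Definition ideal (xi : gboundary) : bordification := inr xi.

Definition represents (u : bordification) : set (nat -> X) :=
  match u with
  | inl p => [set cst p]
  | inr xi => sval xi
  end.

(* [ideal_nbhd o xi t] is the usual basic neighbourhood of [xi] in the
   bordification: the points [u] for which some sequences [x], [y]
   representing [xi], [u] satisfy <x_i, y_j>_o >= t for all large [i], [j]. *)
Definition ideal_nbhd o (xi : gboundary) (t : R) : set bordification :=
  [set u | exists x y, [/\ sval xi x, represents u y &
    \forall ij \near (\oo, \oo), t <= gromov_product o (x ij.1) (y ij.2)]].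

Definition bordification_open : set_system bordification :=
  [set U | open (inner @^-1` U) /\
    forall xi, U (ideal xi) -> forall o, exists t, ideal_nbhd o xi t `<=` U].

Lemma ideal_nbhd_le o xi (s t : R) :
  s <= t -> ideal_nbhd o xi t `<=` ideal_nbhd o xi s.
Proof.
move=> st u [x [y [xix uy H]]]; exists x, y; split=> //.
by near do apply: (le_trans st).
Unshelve. all: by end_near. Qed.

Lemma bordification_openT : bordification_open setT.
Proof.
split; first by rewrite preimage_setT; exact: openT.
by move=> xi _ o; exists 0.
Qed.

Lemma bordification_openI : setI_closed bordification_open.
Proof.
move=> A B [oA bA] [oB bB]; split; first by rewrite preimage_setI; exact: openI.
move=> xi [Axi Bxi] o; have [s sA] := bA _ Axi o; have [t tB] := bB _ Bxi o.
exists (Num.max s t) => u Hu; split; [apply: sA | apply: tB];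
  by apply: ideal_nbhd_le Hu; rewrite le_max lexx ?orbT.
Qed.

Lemma bordification_open_bigU (I : Type) (f : I -> set bordification) :
  (forall i, bordification_open (f i)) -> bordification_open (\bigcup_i f i).
Proof.
move=> H; split.
  by rewrite preimage_bigcup; apply: bigcup_open => i _; have [] := H i.
move=> xi [i _ fxi] o; have [t tf] := (H i).2 _ fxi o.
by exists t => u /tf ?; exists i.
Qed.

HB.instance Definition _ := isOpenTopological.Build bordification
  bordification_openT bordification_openI bordification_open_bigU.

HB.instance Definition _ :=
  Topological.copy gboundary (initial_topology ideal).

End GromovBoundary.

Section Actions.
Context {R : realType}.
Implicit Types (G : groupType) (X : metricType R).

Record isometric_action G X := IsometricAction {
  act :> G -> X -> X;
  act1 : forall p, act 1%g p = p;
  actM : forall g h p, act (g * h)%g p = act g (act h p);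
  act_isometry : forall g p q, mdist (act g p) (act g q) = mdist p q }.

Section Boundary.
Context {G : groupType} {X : metricType R} (a : isometric_action G X).

Lemma actK g p : a g^-1%g (a g p) = p.
Proof. by rewrite -actM mulVg act1. Qed.

Lemma actKV g p : a g (a g^-1%g p) = p.
Proof. by rewrite -actM mulgV act1. Qed.

Lemma gromov_product_act g o p q :
  gromov_product (a g o) (a g p) (a g q) = gromov_product o p q.
Proof. by rewrite /gromov_product !act_isometry. Qed.

Lemma product_to_infty_act g (x y : nat -> X) :
  product_to_infty x y -> product_to_infty (a g \o x) (a g \o y).
Proof.
move=> H o; rewrite -(actKV g o); under eq_fun do rewrite gromov_product_act.
exact: H.
Qed.

Lemma boundary_act_subproof g (xi : gboundary X) :
  exists2 x, gromov_sequence x &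
    [set a g \o y | y in sval xi] = gromov_class x.
Proof.
case: xi => _ /= [x gx ->]; exists (a g \o x); first exact: product_to_infty_act.
apply/seteqP; split=> [_ [y [gy xy] <-]|y [gy xy]].
  by split; exact: product_to_infty_act.
have E (z : nat -> X) : a g^-1%g \o (a g \o z) = z by apply/funext => n /=; rewrite actK.
exists (a g^-1%g \o y); last by apply/funext => n /=; rewrite actKV.
split; first exact: product_to_infty_act.
by rewrite -(E x); exact: product_to_infty_act.
Qed.

Definition boundary_act (g : G) (xi : gboundary X) : gboundary X :=
  exist _ _ (boundary_act_subproof g xi).

Definition boundary_fix (g : G) : set (gboundary X) :=
  [set xi | boundary_act g xi = xi].

Definition limit_set : set (gboundary X) :=
  [set xi | forall o : X, closure (range (fun g => inner (a g o))) (ideal xi)].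

Definition accumulation_points (E : set G) : set (gboundary X) :=
  [set xi | forall o : X,
    limit_point ((fun g => inner (a g o)) @` E) (ideal xi)].

(* When [X] is nonempty the limit exists, and it is the same for every [o]. *)
Definition translation_length (g : G) : R :=
  get [set l : R | forall o : X,
    mdist (a (g ^+ n)%g o) o / n%:R @[n --> \oo] --> l].

Definition hyperbolic_elt (g : G) : Prop := 0 < translation_length g.

Definition non_elementary : Prop :=
  exists g h, [/\ hyperbolic_elt g, hyperbolic_elt h &
    boundary_fix g `&` boundary_fix h = set0].

Definition quasi_parabolic : Prop :=
  [/\ exists g, hyperbolic_elt g,
      exists! xi : gboundary X, forall g, boundary_act g xi = xi &
      three_points limit_set].

Definition proper_action : Prop :=
  forall (r : R) (o : X), 0 < r -> finite_set [set g | mdist (a g o) o <= r].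

End Boundary.

(* [phi] and [psi] are only relevant on the limit sets, where they are
   mutually inverse. *)
Definition comparable_actions G X (Y : metricType R)
    (a : isometric_action G X) (b : isometric_action G Y) : Prop :=
  exists (phi : gboundary X -> gboundary Y) (psi : gboundary Y -> gboundary X),
    [/\ set_fun (limit_set a) (limit_set b) phi,
        set_fun (limit_set b) (limit_set a) psi,
        {in limit_set a, cancel phi psi} &
        {in limit_set b, cancel psi phi}] /\
    [/\ {within limit_set a, continuous phi},
        {within limit_set b, continuous psi} &
        forall g, {in limit_set a, forall xi,
          phi (boundary_act a g xi) = boundary_act b g (phi xi)}].

End Actions.

Definition expgz (G : groupType) (g : G) (n : int) : G :=
  match n with
  | Posz k => (g ^+ k)%g
  | Negz k => (g ^- k.+1)%g
  end.

Definition primitive_elt (G : groupType) (g : G) : Prop :=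
  forall (h : G) (n : int), 1 < `|n| -> g <> expgz h n.

(* Main.v *)
Require Import Defs.
From HB Require Import structures.
From mathcomp Require Import all_boot all_order all_algebra.
From mathcomp Require Import all_classical all_reals all_analysis.
From mathcomp Require Import lra.
Import Order.TTheory GRing.Theory Num.Theory.
Import numFieldNormedType.Exports.
Local Open Scope classical_set_scope.
Local Open Scope ring_scope.

(** The set [E] may depend on both actions. If the two length functions agree,
    any sparse sequence converging to [xi] will do; if they differ, it is enough
    that [E] also contains one element at which they differ. So [E] is the
    range of a sequence whose first term has different lengths whenever
    possible, whose other terms tend to [xi], and whose [n]-th term is longer,
    in both actions, than a threshold beyond which [f] is at least [n.+1]. What has
    to be found are therefore elements that are arbitrarily long in both
    actions, are primitive when the action on [X] is proper, and either move the
    base point close to [xi] ([long_elements_near]) or have different lengths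
    ([long_distinguishing_element]).

    They all have the form [w * k ^+ n] with [k] hyperbolic and [n] large. Let
    [alpha] and [beta] be the attracting and repelling points of [k]. If
    [w alpha] differs from [beta], the displacement and the translation length
    of [w * k ^+ n] both equal the displacement of [k ^+ n] up to a constant
    ([tl_mul_exp]); this follows from a local-to-global principle for orbits
    ([orbit_no_backtrack]). So the lengths tend to infinity, and divided by [n]
    they tend to the length of [k]: if the lengths of [k] differ, so do those of
    [w * k ^+ n] for arbitrarily large [n].

    The two actions communicate through the equivariant homeomorphism [phi] of the
    limit sets. If [g n o] tends to [xi] in [X], then [g n] moves two out of any
    three limit points towards [xi], hence moves their images towards [phi xi],
    and this forces [g n o'] to tend to [phi xi] in [Y] ([orbit_transfer]). In
    particular an element is hyperbolic in both actions or in neither, and [phi]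
    matches its endpoints ([hyperbolic_common]).

    For elements near [xi], take [g n o] tending to [xi] and a hyperbolic [h] not
    fixing [xi]. Seen from [o], the point [g n^-1 o] cannot be close to both
    endpoints of [h]; for the one it is not close to, attracting for [k = h] or
    [k = h^-1], the points [g n (k^j o)] stay close to [xi]. If every element of
    the group fixes [xi], the action is quasi-parabolic, [xi] is an endpoint of
    every hyperbolic element, and powers of one of them tend to [xi]; this does
    not happen in a proper action ([proper_moves]).

    Finally, in a proper action [w * k ^+ n] is primitive for all large [n] as
    soon as [w alpha] is neither [alpha] nor [beta] ([mul_exp_primitive]): a
    proper root would shift a long piece of the axis of [k] along itself, hence
    commute with a power of [k] by properness, which makes [w] preserve the
    endpoints of [k]. *)

Set Implicit Arguments.
Unset Strict Implicit.
Unset Printing Implicit Defensive.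

(** * Gromov products *)

Section GromovProduct.
Context {R : realType} {X : metricType R}.
Implicit Types (o p q r : X) (x y z : nat -> X) (t : R).
Local Notation gp := gromov_product.

Lemma gp_sym o p q : gp o p q = gp o q p.
Proof. by rewrite /gromov_product (metric_sym p q) (addrC (mdist p o)). Qed.

Lemma gp_ge0 o p q : 0 <= gp o p q.
Proof.
have := metric_triangle p o q; rewrite /gromov_product (metric_sym o q); lra.
Qed.

Lemma gp_le o p q : gp o p q <= mdist p o.
Proof.
have := metric_triangle q p o; rewrite /gromov_product (metric_sym q p); lra.
Qed.

Lemma gpxx o p : gp o p p = mdist p o.
Proof. by rewrite /gromov_product mdistxx; lra. Qed.

Lemma gp_lip o p q q' : gp o p q - mdist q q' <= gp o p q'.
Proof.
have := metric_triangle p q q'; have := metric_triangle q q' o.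
rewrite /gromov_product; lra.
Qed.

Lemma gp_base o o' p q : gp o p q - mdist o o' <= gp o' p q.
Proof.
have := metric_triangle p o' o; have := metric_triangle q o' o.
rewrite /gromov_product (metric_sym o' o); lra.
Qed.

Lemma gp_swap o p q : gp o p q = mdist p o - gp p o q.
Proof.
by rewrite /gromov_product (metric_sym o p) (metric_sym q p) (metric_sym o q); lra.
Qed.

(** A point [p] close to the line joining [q] and [r] looks, from [o], at
    least as close to [q] as [r] does; only the triangle inequality is used. *)
Lemma gp_side o p q r : gp o q r - gp p q r <= gp o p q.
Proof.
have := metric_triangle r p o.
rewrite /gromov_product (metric_sym p q) (metric_sym r p); lra.
Qed.

(** The Gromov inequality with an explicit constant and without a minimum. *)
Definition thin (delta : R) : Prop := 0 < delta /\ forall o p q r t,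
  t <= gp o p r -> t <= gp o r q -> t - delta <= gp o p q.

Lemma gromov_hyperbolic_thin : gromov_hyperbolic X -> exists delta, thin delta.
Proof.
move=> [d [d0 H]]; exists d; split=> // o p q r t h1 h2.
by apply: le_trans (H o p q r); rewrite lerD2r le_min h1.
Qed.

(** Lower bound on the Gromov product of the limits of [x] and [y] (a point of
    [X] being the limit of a constant sequence). *)
Definition prod_ge o x y t : Prop :=
  exists N, forall i j, (N <= i)%N -> (N <= j)%N -> t <= gp o (x i) (y j).

Lemma near_prod_ge o x y t :
  (\forall ij \near (\oo, \oo), t <= gp o (x ij.1) (y ij.2)) <-> prod_ge o x y t.
Proof.
split=> [[[A B] /= [[n _ nA] [m _ mB]] AB]|[N H]].
  exists (maxn n m) => i j; rewrite !geq_max => /andP[ni mi] /andP[nj mj].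
  by apply: (AB (i, j)); split; [exact: nA | exact: mB].
exists ([set i | (N <= i)%N], [set j | (N <= j)%N]) => /=.
  by split; exists N.
by move=> [i j] /= [Ni Nj]; exact: H.
Qed.

Lemma prod_ge_sym {o x y t} : prod_ge o x y t -> prod_ge o y x t.
Proof. by move=> [N H]; exists N => i j Ni Nj; rewrite gp_sym; exact: H. Qed.

Lemma prod_ge_le s {o x y t} : s <= t -> prod_ge o x y t -> prod_ge o x y s.
Proof. by move=> st [N H]; exists N => i j Ni Nj; apply: le_trans st _; exact: H. Qed.

Lemma prod_ge_trans {delta} (hyp : thin delta) y {o x z t} :
  prod_ge o x y t -> prod_ge o y z t -> prod_ge o x z (t - delta).
Proof.
move=> [N H] [M K]; exists (maxn N M) => i j.
rewrite !geq_max => /andP[Ni Mi] /andP[Nj Mj].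
by apply: (hyp.2 _ _ _ (y (maxn N M))); [apply: H | apply: K] => //;
  rewrite ?leq_maxl ?leq_maxr.
Qed.

Lemma prod_ge_lip {o x y t} y' C :
  (forall n, mdist (y n) (y' n) <= C) -> prod_ge o x y t -> prod_ge o x y' (t - C).
Proof.
move=> yy' [N H]; exists N => i j Ni Nj.
have := gp_lip o (x i) (y j) (y' j); have := H _ _ Ni Nj; have := yy' j; lra.
Qed.

Lemma prod_ge_base o' {o x y t} :
  prod_ge o x y t -> prod_ge o' x y (t - mdist o o').
Proof.
move=> [N H]; exists N => i j Ni Nj.
have := gp_base o o' (x i) (y j); have := H _ _ Ni Nj; lra.
Qed.

Lemma product_to_inftyP x y :
  product_to_infty x y <-> forall o t, prod_ge o x y t.
Proof.
split=> [H o t|H o].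
  by apply/near_prod_ge; move/cvgryPge: (H o); exact.
by apply/cvgryPge => t; apply/near_prod_ge; exact: H.
Qed.

Lemma prod_ge_infty o x y :
  (forall t, prod_ge o x y t) -> product_to_infty x y.
Proof.
move=> H; apply/product_to_inftyP => o' t.
apply: prod_ge_le (prod_ge_base o' (H (t + mdist o o'))); lra.
Qed.

End GromovProduct.

Arguments prod_ge_trans {R X delta} hyp y {o x z t}.
Arguments prod_ge_le {R X} s {o x y t}.
Arguments prod_ge_lip {R X o x y t} y' C.
Arguments prod_ge_base {R X} o' {o x y t}.

(** * Sequences converging to boundary points *)

Section Boundary.
Context {R : realType} {X : metricType R} (delta : R) (hyp : @thin R X delta).
Implicit Types (o p q : X) (x y z : nat -> X) (xi eta : gboundary X) (t : R).
Local Notation gp := gromov_product.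

Lemma rep_ge xi x y : sval xi x -> sval xi y -> forall o t, prod_ge o x y t.
Proof.
case: xi => _ /= [z gz ->] [gx zx] [gy zy] o t.
move/product_to_inftyP: zx => /(_ o (t + delta)) zx.
move/product_to_inftyP: zy => /(_ o (t + delta)) zy.
apply: prod_ge_le (prod_ge_trans hyp z (prod_ge_sym zx) zy); lra.
Qed.

Lemma rep_ext o xi x y :
  sval xi x -> (forall t, prod_ge o x y t) -> sval xi y.
Proof.
case: xi => _ /= [z gz ->] [gx zx] xy; split.
  apply: (prod_ge_infty (o := o)) => t.
  have h := xy (t + delta); apply: prod_ge_le (prod_ge_trans hyp x (prod_ge_sym h) h).
  lra.
apply: (prod_ge_infty (o := o)) => t.
move/product_to_inftyP: zx => /(_ o (t + delta)) zx.
apply: prod_ge_le (prod_ge_trans hyp x zx (xy (t + delta))); lra.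
Qed.

Lemma rep_ex o x : (forall t, prod_ge o x x t) -> exists xi, sval xi x.
Proof.
move=> H; have gx := prod_ge_infty H.
have P : exists2 x', gromov_sequence x' & gromov_class x = gromov_class x' by exists x.
by exists (exist _ _ P : gboundary X).
Qed.

Lemma gboundary_inj xi eta : sval xi = sval eta -> xi = eta.
Proof.
case: xi eta => [s p] [s' p'] /= E; rewrite E in p *.
by congr exist; exact: Prop_irrelevance.
Qed.

Lemma rep_eq_ge o xi eta x y : sval xi x -> sval eta y ->
  (forall t, prod_ge o x y t) -> xi = eta.
Proof.
move=> xix etay xy; apply: gboundary_inj; apply/seteqP; split=> z zz.
  apply: (rep_ext (o := o) (x := y)) => // t.
  have h := rep_ge xix zz o (t + delta).
  apply: prod_ge_le (prod_ge_trans hyp x (prod_ge_sym (xy (t + delta))) h); lra.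
apply: (rep_ext (o := o) (x := x)) => // t.
have h := rep_ge etay zz o (t + delta).
apply: prod_ge_le (prod_ge_trans hyp y (xy (t + delta)) h); lra.
Qed.

Lemma rep_eq xi eta x : sval xi x -> sval eta x -> xi = eta.
Proof. by move=> h k; apply: (rep_eq_ge (o := x 0%N) h k) => t; exact: (rep_ge h h). Qed.

Lemma rep_nonempty xi : exists x, sval xi x.
Proof. by case: xi => _ /= [x gx ->]; exists x; split. Qed.

Lemma rep_near xi x y C : sval xi x -> (forall n, mdist (x n) (y n) <= C) -> sval xi y.
Proof.
move=> xix xy; apply: (rep_ext (o := x 0%N) xix) => t.
apply: prod_ge_le (prod_ge_lip y C xy (rep_ge xix xix (x 0%N) (t + C))); lra.
Qed.

Lemma rep_sub xi x (s : nat -> nat) :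
  (forall n, (n <= s n)%N) -> sval xi x -> sval xi (x \o s).
Proof.
move=> ns xix; apply: (rep_ext (o := x 0%N) xix) => t.
have [N H] := rep_ge xix xix (x 0%N) t; exists N => i j Ni Nj.
by apply: H => //; exact: leq_trans Nj (ns j).
Qed.

(** Distinct boundary points have bounded Gromov product. Some entries stay
    below a threshold [t] arbitrarily far out, and all far entries of [x] (of
    [y]) have large product with each other, so all far entries do. *)
Lemma rep_bounded o xi eta x y : sval xi x -> sval eta y -> xi <> eta ->
  exists C, forall i j, gp o (x i) (y j) <= C.
Proof.
move=> xix etay ne.
have [t nt] : exists t, ~ prod_ge o x y t.
  by apply: contrapT => H; apply: ne; apply: (rep_eq_ge (o := o) xix etay) => t;
    apply: contrapT => K; apply: H; exists t.
have [N HN] := rep_ge xix xix o (t + delta + delta).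
have [M HM] := rep_ge etay etay o (t + delta + delta).
have far i j : (N <= i)%N -> (M <= j)%N -> gp o (x i) (y j) <= t + delta + delta.
  move=> Ni Mj; rewrite leNgt; apply/negP => big; apply: nt.
  exists (maxn N M) => i' j'; rewrite !geq_max => /andP[Ni' _] /andP[_ Mj'].
  have h := hyp.2 o _ _ _ _ (HN i' i Ni' Ni) (ltW big).
  have h' : t + delta + delta - delta <= gp o (y j) (y j').
    have := HM j j' Mj Mj'; have := hyp.1; lra.
  have := hyp.2 _ _ _ _ _ h h'; lra.
pose S1 := \sum_(i < N) mdist (x i) o; pose S2 := \sum_(i < M) mdist (y i) o.
have S10 : 0 <= S1 by apply: sumr_ge0 => *; exact: mdist_ge0.
have S20 : 0 <= S2 by apply: sumr_ge0 => *; exact: mdist_ge0.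
have sum_le (u : nat -> X) K i : (i < K)%N -> mdist (u i) o <= \sum_(i < K) mdist (u i) o.
  move=> iK; rewrite (bigD1 (Ordinal iK)) //= lerDl.
  by apply: sumr_ge0 => *; exact: mdist_ge0.
exists (`|t + delta + delta| + S1 + S2) => i j.
have tn := ler_norm (t + delta + delta); have t0 := normr_ge0 (t + delta + delta).
have [Ni|iN] := leqP N i.
  have [Mj|jM] := leqP M j; first by have := far i j Ni Mj; lra.
  have := gp_le o (y j) (x i); have := sum_le y M j jM; rewrite gp_sym -/S2; lra.
have := gp_le o (x i) (y j); have := sum_le x N i iN; rewrite -/S1; lra.
Qed.

(** Otherwise some terms of [y] and of [y'] would both be close to [p] as seen
    from [o], hence close to each other by the Gromov inequality. *)
Lemma one_side_bounded o y y' C p : (forall i j, gp o (y i) (y' j) <= C) ->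
  (forall i, gp o (y i) p <= C + delta) \/ (forall j, gp o (y' j) p <= C + delta).
Proof.
move=> yy'; apply: contrapT => /not_orP[/existsNP[i /negP] + /existsNP[j /negP]].
rewrite -!ltNge => hi hj.
pose e := Num.min (gp o (y i) p) (gp o (y' j) p).
have eC : C + delta < e by rewrite lt_min hi hj.
have : e - delta <= gp o (y i) (y' j).
  apply: (hyp.2 o _ _ p); first by rewrite ge_min lexx.
  by rewrite gp_sym ge_min lexx orbT.
by have := yy' i j; lra.
Qed.

(** * The topology of the bordification *)

Lemma ideal_nbhdP o xi t u : ideal_nbhd o xi t u <->
  exists x y, [/\ sval xi x, represents u y & prod_ge o x y t].
Proof.
by split=> -[x [y [h1 h2 /near_prod_ge h3]]]; exists x, y; split=> //; exact/near_prod_ge.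
Qed.

(** In the definition of a basic neighbourhood the sequence representing the
    centre varies with the point; fixing it costs [delta]. *)
Lemma ideal_nbhd_rep o xi x t u : sval xi x -> ideal_nbhd o xi t u ->
  exists2 y, represents u y & prod_ge o x y (t - delta).
Proof.
move=> xix /ideal_nbhdP[z [y [xiz uy zy]]]; exists y => //.
exact: (prod_ge_trans hyp z (rep_ge xix xiz o t) zy).
Qed.

Lemma ideal_nbhd_inner o xi x t p : sval xi x -> ideal_nbhd o xi t (inner p) ->
  prod_ge o x (cst p) (t - delta).
Proof. by move=> xix /(ideal_nbhd_rep xix)[y /= ->]. Qed.

Lemma ideal_nbhd_ideal o xi eta x y t : sval xi x -> sval eta y ->
  ideal_nbhd o xi t (ideal eta) -> prod_ge o x y (t - delta - delta).
Proof.
move=> xix etay /(ideal_nbhd_rep xix)[z /= etaz xz].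
exact: (prod_ge_trans hyp z xz (rep_ge etaz etay _ _)).
Qed.

Lemma prod_ge_cstP o x p t : prod_ge o x (cst p) t <->
  exists N, forall i, (N <= i)%N -> t <= gp o (x i) p.
Proof.
split=> [[N H]|[N H]]; exists N; first by move=> i Ni; exact: H Ni (leqnn _).
by move=> i j Ni _; exact: H.
Qed.

(** The basic neighbourhoods need not be open, but they are neighbourhoods: the
    points around which a smaller basic neighbourhood still fits form an open
    set, since by the Gromov inequality a basic neighbourhood of radius
    [s + 2 delta] lies in that set as soon as the one of radius [s] fits. *)
Lemma nbhs_ideal_nbhd o xi t : nbhs (ideal xi) (ideal_nbhd o xi t).
Proof.
pose N := ideal_nbhd o xi t.
pose U : set (bordification X) := fun u => match u with
  | inl p => nbhs p (@inner _ X @^-1` N)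
  | inr eta => exists s, ideal_nbhd o eta s `<=` N end.
rewrite nbhsE; exists U; last first.
  case=> [p|eta] /=; first exact: (@nbhs_singleton _ p (@inner _ X @^-1` N)).
  move=> [s sN]; have [y etay] := rep_nonempty eta.
  by apply: sN; apply/ideal_nbhdP; exists y, y; split=> //; exact: (rep_ge etay etay).
split; last by exists t.
split.
  by rewrite openE => p /= /nbhs_interior; exact.
move=> eta [s sN] o'.
exists (s + 2 * delta + 1 + mdist o' o) => u /ideal_nbhdP[x [y [etax uy xy0]]].
have xy : prod_ge o x y (s + 2 * delta + 1).
  by apply: prod_ge_le (prod_ge_base o xy0); lra.
case: u uy => [p|zeta] /= uy.
  rewrite uy in xy; apply/nbhs_ballP; exists 1 => //= q; rewrite ballEmdist /= => pq.
  apply: sN; apply/ideal_nbhdP; exists x, (cst q); split=> //.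
  apply: prod_ge_le (prod_ge_lip (cst q) 1 _ xy); last by move=> n /=; exact: ltW.
  have := hyp.1; lra.
exists (s + 2 * delta + 1) => v /ideal_nbhdP[y' [z [zetay' vz y'z]]].
apply: sN; apply/ideal_nbhdP; exists x, z; split=> //.
have xy' := prod_ge_trans hyp y xy (rep_ge uy zetay' _ _).
have y'z' : prod_ge o y' z (s + 2 * delta + 1 - delta).
  by apply: prod_ge_le y'z; have := hyp.1; lra.
by apply: prod_ge_le (prod_ge_trans hyp y' xy' y'z'); lra.
Qed.

Lemma nbhs_idealP o xi (U : set (bordification X)) :
  nbhs (ideal xi) U -> exists t, ideal_nbhd o xi t `<=` U.
Proof.
rewrite nbhsE => -[V [[_ oV] Vxi] VU].
by have [t tV] := oV _ Vxi o; exists t; apply: subset_trans VU.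
Qed.

End Boundary.

(** * Translation lengths *)

Section Fekete.
Context {R : realType}.
Implicit Types (u : nat -> R) (c l e K : R).

Lemma nat_above c : exists N, forall n, (N <= n)%N -> c < n%:R.
Proof.
exists (Num.bound `|c|) => n Nn; apply: (le_lt_trans (ler_norm c)).
by apply: lt_le_trans (archi_boundP (normr_ge0 c)) _; rewrite ler_nat.
Qed.

(** Fekete's subadditive lemma: Euclidean division of [n] by an [m] at which
    [u m / m] almost attains its infimum bounds [u n / n]. *)
Lemma fekete u : (forall n, 0 <= u n) -> (forall m n, u (m + n)%N <= u m + u n) ->
  exists l, [/\ 0 <= l, forall n, n%:R * l <= u n &
    forall e, 0 < e -> exists N, forall n, (N <= n)%N -> u n <= n%:R * (l + e)].
Proof.
move=> u0 usub; pose A := [set u n.+1 / n.+1%:R | n in [set: nat]].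
have n0 n : (0 : R) < n.+1%:R by rewrite ltr0n.
have lbA : lbound A 0 by move=> _ [n _ <-]; rewrite divr_ge0 // ltW.
have neA : A !=set0 by exists (u 1%N / 1%:R), 0%N.
have hA : has_inf A by split=> //; exists 0.
exists (inf A); split; first exact: lb_le_inf.
  case=> [|n]; first by rewrite mul0r.
  by rewrite mulrC -ler_pdivlMr //; apply: ge_inf; [exists 0 | exists n].
move=> e e0; have e20 : 0 < e / 2 by rewrite divr_gt0.
have [_ [m _ <-]] := inf_adherent e20 hA.
rewrite ltr_pdivrMr // => um.
pose M := \sum_(r < m.+1) u r.
have uM r : (r < m.+1)%N -> u r <= M.
  move=> rm; rewrite /M (bigD1 (Ordinal rm)) //= lerDl.
  by apply: sumr_ge0 => *; exact: u0.
have [N HN] := nat_above ((u 0%N + M) / (e / 2)); exists N => n /HN.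
rewrite ltr_pdivrMr // => nM.
have umul q : u (q * m.+1)%N <= q%:R * u m.+1 + u 0%N.
  elim: q => [|q IH]; first by rewrite mul0n mul0r add0r.
  rewrite mulSn -natr1 mulrDl mul1r; apply: le_trans (usub _ _) _; lra.
have := usub (n %/ m.+1 * m.+1)%N (n %% m.+1)%N; rewrite -divn_eq.
have := umul (n %/ m.+1)%N; have := uM _ (ltn_pmod n (ltn0Sn m)).
have l0 : 0 <= inf A by exact: lb_le_inf.
have qn : (n %/ m.+1)%:R * m.+1%:R <= n%:R :> R by rewrite -natrM ler_nat leq_divM.
have h1 : (n %/ m.+1)%:R * u m.+1 <= (n %/ m.+1)%:R * ((inf A + e / 2) * m.+1%:R).
  by apply: ler_wpM2l; [rewrite ler0n | exact: ltW].
have h2 : (n %/ m.+1)%:R * m.+1%:R * (inf A + e / 2) <= n%:R * (inf A + e / 2).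
  by apply: ler_wpM2r => //; lra.
lra.
Qed.

(** A linear lower bound up to an additive constant survives division by [n]. *)
Lemma linear_le c l K u :
  (forall e, 0 < e -> exists N, forall n, (N <= n)%N -> u n <= n%:R * (l + e)) ->
  (forall n, exists2 m, (n <= m)%N & m%:R * c <= u m + K) -> c <= l.
Proof.
move=> ul cu; apply/ler_addgt0Pr => e e0.
have e20 : 0 < e / 2 by rewrite divr_gt0.
have [N HN] := ul _ e20; have [M HM] := nat_above (K / (e / 2)).
have [n nNM] := cu (maxn N M); rewrite geq_max in nNM; case/andP: nNM => Nn Mn.
have := HM n Mn; rewrite ltr_pdivrMr // => h3; have h2 := HN n Nn => h1.
rewrite leNgt; apply/negP => h4.
have : 0 <= n%:R * (c - l - e) by rewrite mulr_ge0 //; lra.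
lra.
Qed.
End Fekete.

Section TranslationLength.
Context {R : realType} {G : groupType} {X : metricType R}.
Context (a : isometric_action G X).
Implicit Types (o p q : X) (g h : G).
Local Notation gp := gromov_product.
Local Notation tl := (translation_length a).

Lemma act_inv_dist g p q : mdist (a g^-1%g p) q = mdist p (a g q).
Proof. by rewrite -(act_isometry a g) actKV. Qed.

Lemma disp_inv g o : mdist (a g^-1%g o) o = mdist (a g o) o.
Proof. by rewrite act_inv_dist metric_sym. Qed.

Lemma disp_mul g h o : mdist (a (g * h)%g o) o <= mdist (a g o) o + mdist (a h o) o.
Proof.
rewrite actM; have := metric_triangle (a g (a h o)) (a g o) o.
rewrite act_isometry; lra.
Qed.

Lemma disp_base g o p : mdist (a g p) p <= mdist (a g o) o + 2 * mdist o p.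
Proof.
have := metric_triangle (a g p) (a g o) p; have := metric_triangle (a g o) o p.
rewrite act_isometry (metric_sym p o); lra.
Qed.

Lemma disp_exp1 g o n : mdist (a (g ^+ n)%g o) o <= n%:R * mdist (a g o) o.
Proof.
elim: n => [|n IH]; first by rewrite expg0 act1 mdistxx mul0r.
by rewrite expgS -natr1 mulrDl mul1r addrC; apply: le_trans (disp_mul _ _ _) _; rewrite lerD2l.
Qed.

Lemma tl_spec g (o0 : X) : [/\ 0 <= tl g,
  forall o n, n%:R * tl g <= mdist (a (g ^+ n)%g o) o &
  forall o e, 0 < e -> exists N, forall n, (N <= n)%N ->
    mdist (a (g ^+ n)%g o) o <= n%:R * (tl g + e)].
Proof.
have F o : exists l, [/\ 0 <= l, forall n, n%:R * l <= mdist (a (g ^+ n)%g o) o &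
  forall e, 0 < e -> exists N, forall n, (N <= n)%N ->
    mdist (a (g ^+ n)%g o) o <= n%:R * (l + e)].
  apply: fekete => [n|m n]; first exact: mdist_ge0.
  by rewrite expgnDr; exact: disp_mul.
have [l [l0 ll lu]] := F o0.
have Fl o : (forall n, n%:R * l <= mdist (a (g ^+ n)%g o) o) /\
  forall e, 0 < e -> exists N, forall n, (N <= n)%N ->
    mdist (a (g ^+ n)%g o) o <= n%:R * (l + e).
  have [l' [_ ll' lu']] := F o.
  suff -> : l = l' by split.
  apply/eqP; rewrite eq_le; apply/andP; split.
    apply: (linear_le (K := 2 * mdist o o0) lu') => n; exists n => //.
    by apply: le_trans (ll n) _; exact: disp_base.
  apply: (linear_le (K := 2 * mdist o0 o) lu) => n; exists n => //.
  by apply: le_trans (ll' n) _; exact: disp_base.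
suff -> : tl g = l by split=> // o; case: (Fl o).
have lim o : mdist (a (g ^+ n)%g o) o / n%:R @[n --> \oo] --> l.
  apply/cvgrPdist_le => e e0; have [N HN] := (Fl o).2 e e0.
  exists N.+1 => // n /= Nn; have n0 : (0 : R) < n%:R by rewrite ltr0n; exact: leq_trans Nn.
  have := HN n (ltnW Nn); have := (Fl o).1 n; rewrite !(mulrC n%:R) => h1 h2.
  rewrite distrC ler_distl ler_pdivlMr // ler_pdivrMr // h2 andbT.
  by apply: le_trans h1; rewrite ler_wpM2r //; lra.
have tll o : mdist (a (g ^+ n)%g o) o / n%:R @[n --> \oo] --> tl g.
  by apply: (@getI _ [set l : R | forall o : X,
    mdist (a (g ^+ n)%g o) o / n%:R @[n --> \oo] --> l] l lim).
by apply: (cvg_unique _ (tll o0) (lim o0)).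
Qed.

Lemma tl_ge0 (o : X) g : 0 <= tl g. Proof. by have [] := tl_spec g o. Qed.

Lemma tl_le o g n : n%:R * tl g <= mdist (a (g ^+ n)%g o) o.
Proof. by have [_ h _] := tl_spec g o. Qed.

Lemma tl_le1 o g : tl g <= mdist (a g o) o.
Proof. by have := tl_le o g 1; rewrite mul1r expg1. Qed.

Lemma tl_approx o g e : 0 < e -> exists N, forall n, (N <= n)%N ->
  mdist (a (g ^+ n)%g o) o <= n%:R * (tl g + e).
Proof. by have [_ _ h] := tl_spec g o; exact: h. Qed.

Lemma tl_ge o g c K :
  (forall n, n%:R * c <= mdist (a (g ^+ n)%g o) o + K) -> c <= tl g.
Proof. by move=> H; apply: (linear_le (K := K) (tl_approx o g)) => n; exists n. Qed.

Lemma expg_conj g h n : ((g * h * g^-1) ^+ n = g * h ^+ n * g^-1)%g.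
Proof.
elim: n => [|n IH]; first by rewrite !expg0 mulg1 mulgV.
by rewrite !expgS IH -!mulgA (mulgA g^-1%g g) mulVg mul1g !mulgA.
Qed.

Lemma tl_conj_ge (o : X) g h : tl h <= tl (g * h * g^-1)%g.
Proof.
apply: (@tl_ge (a g o) _ _ 0) => n; rewrite addr0 expg_conj !actM actK act_isometry.
exact: tl_le.
Qed.

Lemma disp_expV g o n : mdist (a (g^-1 ^+ n)%g o) o = mdist (a (g ^+ n)%g o) o.
Proof. by rewrite expVgn disp_inv. Qed.

Context (delta : R) (hyp : @thin R X delta).

Lemma gp_shift g o q : gp (a g o) o (a g q) = gp o (a g^-1%g o) q.
Proof. by rewrite -(gromov_product_act a g o) actKV. Qed.

(** Local-to-global principle: if an orbit segment [g^-1 o, o, g o] backtracks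
    little compared to its length, then so does the whole orbit of [g]. By
    induction, the next point of the orbit is seen from [o] in almost the same
    direction as [g o]. *)
Lemma orbit_no_backtrack g o A : gp o (a g o) (a g^-1%g o) <= A ->
  2 * A + 2 * delta < mdist (a g o) o ->
  forall n, gp o (a g^-1%g o) (a (g ^+ n.+1)%g o) <= A + delta.
Proof.
move=> gA gL; have d0 := hyp.1; elim=> [|n IH].
  by rewrite expg1 gp_sym; lra.
have far : mdist (a g o) o - A - delta <= gp o (a g o) (a (g ^+ n.+2)%g o).
  by rewrite gp_swap expgS actM gp_shift; lra.
rewrite leNgt; apply/negP => big.
pose e := Num.min (gp o (a g^-1%g o) (a (g ^+ n.+2)%g o)) (mdist (a g o) o - A - delta).
have eA : A + delta < e by rewrite lt_min big /=; lra.
have : e - delta <= gp o (a g^-1%g o) (a g o).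
  apply: (hyp.2 o _ _ (a (g ^+ n.+2)%g o)); first by rewrite ge_min lexx.
  by rewrite gp_sym; apply: le_trans far; rewrite ge_min lexx orbT.
rewrite gp_sym; lra.
Qed.

Lemma orbit_far g o A : gp o (a g o) (a g^-1%g o) <= A ->
  2 * A + 2 * delta < mdist (a g o) o ->
  forall n, mdist (a g o) o - A - delta <= gp o (a g o) (a (g ^+ n.+1)%g o).
Proof.
move=> gA gL [|n]; last first.
  by rewrite gp_swap expgS actM gp_shift; have := orbit_no_backtrack gA gL n; lra.
by rewrite expg1 gpxx; have := hyp.1; have := gp_ge0 o (a g o) (a g^-1%g o); lra.
Qed.

Lemma tl_lower g o A : gp o (a g o) (a g^-1%g o) <= A ->
  mdist (a g o) o - 2 * A - 2 * delta <= tl g.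
Proof.
move=> gA; have d0 := hyp.1.
have [small|gL] := leP (mdist (a g o) o) (2 * A + 2 * delta).
  by have := tl_ge0 o g; lra.
apply: (@tl_ge o _ _ 0) => n; rewrite addr0.
have A0 := gp_ge0 o (a g o) (a g^-1%g o).
elim: n => [|[|n] IH]; first by rewrite mul0r; exact: mdist_ge0.
  by rewrite expg1 mul1r; lra.
have := orbit_no_backtrack gA gL n.
have := act_inv_dist g o (a (g ^+ n.+1)%g o).
rewrite -(actM a g) -expgS /gromov_product disp_inv (metric_sym o).
have -> : n.+2%:R = n.+1%:R + 1 :> R by rewrite natr1.
by rewrite (mulrDl _ 1) mul1r => E1 E2; move: IH; lra.
Qed.

Lemma orbit_line g o A : gp o (a g o) (a g^-1%g o) <= A ->
  2 * A + 3 * delta < mdist (a g o) o ->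
  forall j n, gp o (a (g ^+ j)%g o) (a (g^-1 ^+ n)%g o) <= A + 2 * delta.
Proof.
move=> gA gL j n; have d0 := hyp.1.
have A0 : 0 <= A by apply: le_trans gA; exact: gp_ge0.
case: j => [|j].
  rewrite expg0 act1; have := gp_le o o (a (g^-1 ^+ n)%g o); rewrite mdistxx; lra.
case: n => [|n].
  rewrite expg0 act1 gp_sym; have := gp_le o o (a (g ^+ j.+1)%g o).
  rewrite mdistxx; lra.
have gL' : 2 * A + 2 * delta < mdist (a g o) o by lra.
have h1 := orbit_no_backtrack gA gL' j.
have h2 : mdist (a g o) o - A - delta <= gp o (a g^-1%g o) (a (g^-1 ^+ n.+1)%g o).
  by rewrite -(disp_inv g); apply: orbit_far; rewrite ?disp_inv // invgK gp_sym.
rewrite leNgt; apply/negP => big.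
pose e := Num.min (gp o (a (g ^+ j.+1)%g o) (a (g^-1 ^+ n.+1)%g o)) (mdist (a g o) o - A - delta).
have eA : A + 2 * delta < e by rewrite lt_min big /=; lra.
have : e - delta <= gp o (a g^-1%g o) (a (g ^+ j.+1)%g o).
  apply: (hyp.2 o _ _ (a (g^-1 ^+ n.+1)%g o)).
    by apply: le_trans h2; rewrite ge_min lexx orbT.
  by rewrite gp_sym ge_min lexx.
lra.
Qed.

(** * Hyperbolic elements and their fixed points *)

Lemma hyperbolic_no_backtrack h o : 0 < tl h -> exists K, forall m n,
  gp o (a (h ^+ m)%g o) (a (h^-1 ^+ n)%g o) <= K.
Proof.
move=> h0; have d0 := hyp.1.
(* The displacement of [h ^+ m] grows linearly, so it increases by more than
   [3 * delta] from some [m] to [2 * m]: the point [o] then backtracks little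
   under [h ^+ m], compared to its displacement. *)
have [m f2m] : exists m, mdist (a (h ^+ m.+1)%g o) o + 3 * delta
    < mdist (a (h ^+ (m.+1 + m.+1))%g o) o.
  have e0 : 0 < tl h / 2 by rewrite divr_gt0.
  have [N HN] := tl_approx o h e0; have [M HM] := nat_above (3 * delta / (tl h / 2)).
  exists (maxn N M); have := HN (maxn N M).+1 (leqW (leq_maxl _ _)).
  have := HM (maxn N M).+1 (leqW (leq_maxr _ _)); rewrite ltr_pdivrMr //.
  by have := tl_le o h ((maxn N M).+1 + (maxn N M).+1); rewrite natrD; lra.
set v := (h ^+ m.+1)%g in f2m.
pose C := gp o (a v o) (a v^-1%g o).
have CE : 2 * C = 2 * mdist (a v o) o - mdist (a (h ^+ (m.+1 + m.+1))%g o) o.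
  rewrite /C /gromov_product disp_inv (metric_sym (a v o) (a v^-1%g o)).
  rewrite act_inv_dist -actM expgnDr.
  by rewrite -/v (metric_sym o); lra.
have CL : 2 * C + 3 * delta < mdist (a v o) o by lra.
have vv := orbit_line (lexx C) CL.
have near g n : mdist (a ((g ^+ m.+1) ^+ (n %/ m.+1))%g o) (a (g ^+ n)%g o)
    <= m.+1%:R * mdist (a g o) o.
  rewrite {2}(divn_eq n m.+1) expgnDr mulnC expgnA actM act_isometry metric_sym.
  apply: le_trans (disp_exp1 _ _ _) _; apply: ler_wpM2r; first exact: mdist_ge0.
  by rewrite ler_nat ltnW // ltn_pmod.
exists (C + 2 * delta + 2 * (m.+1%:R * mdist (a h o) o)) => j n.
have h1 := near h j; have h2 := near h^-1%g n; rewrite disp_inv expVgn -/v in h2.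
have h3 := vv (j %/ m.+1)%N (n %/ m.+1)%N; rewrite -/v in h1.
have := gp_lip o (a (h ^+ j)%g o) (a (h^-1 ^+ n)%g o) (a (v^-1 ^+ (n %/ m.+1))%g o).
have := gp_lip o (a (v^-1 ^+ (n %/ m.+1))%g o) (a (h ^+ j)%g o) (a (v ^+ (j %/ m.+1))%g o).
rewrite (metric_sym (a (h ^+ j)%g o)) (metric_sym (a (h^-1 ^+ n)%g o)).
rewrite !(gp_sym o (a (v^-1 ^+ (n %/ m.+1))%g o)); lra.
Qed.

End TranslationLength.

Section Endpoints.
Context {R : realType} {G : groupType} {X : metricType R}.
Context (a : isometric_action G X) (delta : R) (hyp : @thin R X delta).
Implicit Types (o p q : X) (g h : G) (xi eta alpha beta : gboundary X).
Local Notation gp := gromov_product.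
Local Notation tl := (translation_length a).
Local Notation bd := (boundary_act a).

Lemma act_rep g xi x : sval xi x -> sval (bd g xi) (fun n => a g (x n)).
Proof. by move=> xix; exists x. Qed.

Lemma bd1 xi : bd 1%g xi = xi.
Proof.
have [x xix] := rep_nonempty xi; apply: (rep_eq hyp (act_rep 1%g xix)).
by rewrite (_ : (fun n => _) = x) //; apply/funext => n; rewrite act1.
Qed.

Lemma bdM g h xi : bd (g * h)%g xi = bd g (bd h xi).
Proof.
have [x xix] := rep_nonempty xi; apply: (rep_eq hyp (act_rep (g * h)%g xix)).
rewrite (_ : (fun n => _) = (fun n => a g (a h (x n)))); last first.
  by apply/funext => n; rewrite actM.
exact: act_rep (act_rep h xix).
Qed.

Lemma bdK g xi : bd g^-1%g (bd g xi) = xi.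
Proof. by rewrite -bdM mulVg bd1. Qed.

Lemma bdKV g xi : bd g (bd g^-1%g xi) = xi.
Proof. by rewrite -bdM mulgV bd1. Qed.

Lemma bd_inj g xi eta : bd g xi = bd g eta -> xi = eta.
Proof. by move=> /(congr1 (bd g^-1%g)); rewrite !bdK. Qed.

Lemma rep_orbit_base xi (g : nat -> G) o p :
  sval xi (fun n => a (g n) o) -> sval xi (fun n => a (g n) p).
Proof.
by move=> h; apply: (rep_near hyp (C := mdist o p) h) => n; rewrite act_isometry.
Qed.

Lemma orbit_rep_ge o xi (g : nat -> G) x T : sval xi x ->
  sval xi (fun n => a (g n) o) -> exists N, forall n, (N <= n)%N ->
    prod_ge o x (cst (a (g n) o)) T /\ T <= mdist (a (g n) o) o.
Proof.
move=> xix gx; have [N H] := rep_ge hyp xix gx o T; exists N => n Nn.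
split; last by apply: le_trans (H n n Nn Nn) _; rewrite gp_sym; exact: gp_le.
by apply/prod_ge_cstP; exists N => i Ni; exact: H.
Qed.

Lemma rep_disp o xi (g : nat -> G) T : sval xi (fun n => a (g n) o) ->
  exists N, forall n, (N <= n)%N -> T <= mdist (a (g n) o) o.
Proof. by move=> h; have [N H] := orbit_rep_ge T h h; exists N => n /H[]. Qed.

Lemma rep_of_nbhds o xi x (g : nat -> G) : sval xi x ->
  (forall T, exists N, forall n, (N <= n)%N -> prod_ge o x (cst (a (g n) o)) T) ->
  sval xi (fun n => a (g n) o).
Proof.
move=> xix H; apply: (rep_ext hyp (o := o) xix) => t.
have [N HN] := H (t + delta); have [M HM] := rep_ge hyp xix xix o (t + delta).
exists (maxn N M) => i j; rewrite !geq_max => /andP[_ Mi] /andP[Nj _].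
have /prod_ge_cstP[K HK] := HN j Nj.
rewrite -[t](addrK delta); apply: (hyp.2 o _ _ (x (maxn M K))).
  by apply: HM; rewrite ?leq_maxl.
by apply: HK; rewrite leq_maxr.
Qed.

(** The orbit meets the basic neighbourhood of [xi] of radius [n] for every [n];
    orbit points chosen there form a sequence converging to [xi]. *)
Lemma limit_setP o xi :
  limit_set a xi <-> exists g : nat -> G, sval xi (fun n => a (g n) o).
Proof.
split=> [lim|[g gx] p].
  have [x xix] := rep_nonempty xi.
  have H (n : nat) : exists g : G, prod_ge o x (cst (a g o)) (n%:R - delta).
    have [_ [[g _ <-] gn]] := lim o _ (nbhs_ideal_nbhd hyp o xi n%:R).
    by exists g; exact: ideal_nbhd_inner gn.
  have [g gH] := choice H; exists g; apply: (rep_of_nbhds xix) => T.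
  have [N HN] := nat_above (T + delta); exists N => n /HN h.
  by apply: prod_ge_le (gH n); lra.
move=> U /(nbhs_idealP p)[t tU].
have gp' := rep_orbit_base p gx; have [N HN] := orbit_rep_ge t gp' gp'.
exists (inner (a (g N) p)); split; first by exists (g N).
apply: tU; apply/ideal_nbhdP; exists (fun n => a (g n) p), (cst (a (g N) p)).
by split=> //; have [] := HN N (leqnn N).
Qed.

Lemma limit_set_act (o : X) g xi : limit_set a xi -> limit_set a (bd g xi).
Proof.
move=> /(limit_setP o)[u ux]; apply/(limit_setP o); exists (fun n => (g * u n)%g).
rewrite (_ : (fun n => _) = (fun n => a g (a (u n) o))); first exact: act_rep.
by apply/funext => n; rewrite actM.
Qed.

Lemma accumulation_points_range o xi (e : nat -> G) :
  sval xi (fun n => a (e n) o) -> accumulation_points a (range e) = [set xi].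
Proof.
move=> ex; apply/seteqP; split=> [zeta acc|_ -> p U]; last first.
  move=> /(nbhs_idealP p)[t tU]; have ep := rep_orbit_base p ex.
  have [N HN] := orbit_rep_ge t ep ep.
  exists (inner (a (e N) p)); split; first by apply/eqP.
    by exists (e N) => //; exists N.
  apply: tU; apply/ideal_nbhdP; exists (fun n => a (e n) p), (cst (a (e N) p)).
  by split=> //; have [] := HN N (leqnn N).
have [z zz] := rep_nonempty zeta.
apply: esym; apply: (rep_eq_ge hyp (o := o) ex zz) => t.
have [N HN] := rep_ge hyp ex ex o (t + delta).
pose M := \sum_(i < N) mdist (a (e i) o) o.
have MN n : (n < N)%N -> mdist (a (e n) o) o <= M.
  move=> nN; rewrite /M (bigD1 (Ordinal nN)) //= lerDl.
  by apply: sumr_ge0 => *; exact: mdist_ge0.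
have [_ [_ [_ [n _ <-] <-] zn]] := acc o _ (nbhs_ideal_nbhd hyp o zeta (`|t| + `|M| + 2 * delta + 1)).
have /prod_ge_cstP[K HK] := ideal_nbhd_inner hyp zz zn.
have [t0 t1] := (normr_ge0 t, ler_norm t); have [M0 M1] := (normr_ge0 M, ler_norm M).
have d0 := hyp.1.
(* A point [a (e n) o] with [n < N] is too close to [o] to be seen near [zeta]. *)
have Nn : (N <= n)%N.
  rewrite leqNgt; apply/negP => /MN; have := gp_le o (a (e n) o) (z K).
  by rewrite gp_sym; have := HK K (leqnn K); lra.
exists (maxn N K) => i j; rewrite !geq_max => /andP[Ni _] /andP[_ Kj].
rewrite -[t](addrK delta); apply: (hyp.2 o _ _ (a (e n) o)); first exact: HN.
by rewrite gp_sym; have := HK j Kj; lra.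
Qed.

(** The form in which hyperbolicity is used: [alpha] attracts and [beta] repels.
    The condition [alpha <> beta] excludes parabolic elements. *)
Definition endpoints o h alpha beta : Prop :=
  [/\ sval alpha (fun n => a (h ^+ n)%g o),
      sval beta (fun n => a (h^-1 ^+ n)%g o) & alpha <> beta].

Lemma endpoints_inv o h alpha beta :
  endpoints o h alpha beta -> endpoints o h^-1%g beta alpha.
Proof. by case=> h1 h2 h3; split=> //; [rewrite invgK | exact: nesym]. Qed.

Lemma ray_converges o h K :
  (forall m n, gp o (a (h ^+ m)%g o) (a (h^-1 ^+ n)%g o) <= K) ->
  (forall T, exists N, forall n, (N <= n)%N -> T <= mdist (a (h ^+ n)%g o) o) ->
  exists alpha, sval alpha (fun n => a (h ^+ n)%g o).
Proof.
move=> hK hT; apply: (rep_ex (o := o)) => t.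
have [N HN] := hT (t + K).
have mono i j : (N <= i)%N -> (i <= j)%N -> t <= gp o (a (h ^+ i)%g o) (a (h ^+ j)%g o).
  move=> Ni ij; rewrite gp_swap -(subnKC ij) expgnDr actM gp_shift gp_sym -expVgn.
  by have := HN i Ni; have := hK (j - i)%N i; lra.
exists N => i j Ni Nj; have [ij|/ltnW ji] := leqP i j; first exact: mono.
by rewrite gp_sym; exact: mono.
Qed.

Lemma hyperbolic_endpoints o h : 0 < tl h -> exists alpha beta, endpoints o h alpha beta.
Proof.
move=> h0; have [K HK] := hyperbolic_no_backtrack hyp o h0.
have hT T : exists N, forall n, (N <= n)%N -> T <= mdist (a (h ^+ n)%g o) o.
  have [N HN] := nat_above (T / tl h); exists N => n /HN.
  by rewrite ltr_pdivrMr // => hn; have := tl_le a o h n; lra.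
have [alpha ha] := ray_converges HK hT.
have [beta hb] : exists beta, sval beta (fun n => a (h^-1 ^+ n)%g o).
  apply: (ray_converges (K := K)) => [m n|T]; first by rewrite invgK gp_sym.
  by have [N HN] := hT T; exists N => n; rewrite disp_expV; exact: HN.
exists alpha, beta; split=> // E; rewrite E in ha.
have [N H] := rep_ge hyp ha hb o (K + 1).
by have := H N N (leqnn N) (leqnn N); have := HK N N; lra.
Qed.

Lemma endpoint_fixed o h alpha : sval alpha (fun n => a (h ^+ n)%g o) -> bd h alpha = alpha.
Proof.
move=> ha; apply: (rep_eq hyp (act_rep h ha)).
have := rep_sub hyp (s := S) (fun n => leqnSn n) ha.
by rewrite (_ : _ \o _ = (fun n => a h (a (h ^+ n)%g o))) //; apply/funext => n /=;
  rewrite expgS actM.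
Qed.

Lemma endpoint_limit o h alpha : sval alpha (fun n => a (h ^+ n)%g o) -> limit_set a alpha.
Proof. by move=> ha; apply/(limit_setP o); exists (fun n => (h ^+ n)%g). Qed.

(** The powers of [h] move every point other than [beta] towards [alpha], while
    a fixed point does not move. *)
Lemma fixed_endpoint o h alpha beta eta :
  endpoints o h alpha beta -> bd h eta = eta -> eta = alpha \/ eta = beta.
Proof.
move=> [ha hb ab] he; apply: contrapT => /not_orP[ea eb].
have [y ey] := rep_nonempty eta.
have [C HC] := rep_bounded hyp o ha ey (nesym ea).
have [D HD] := rep_bounded hyp o hb ey (nesym eb).
have [n fn] : exists n, C + D + delta < mdist (a (h ^+ n)%g o) o.
  have [N HN] := rep_disp (C + D + delta + 1) ha.
  by exists N; have := HN N (leqnn N); lra.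
have hne : bd (h ^+ n)%g eta = eta.
  by elim: (n) => [|k IH]; rewrite ?expg0 ?bd1 // expgS bdM IH.
have hny := act_rep (h ^+ n)%g ey; rewrite hne in hny.
have [N HN] := rep_ge hyp hny ey o (mdist (a (h ^+ n)%g o) o - D).
have h1 : mdist (a (h ^+ n)%g o) o - D <= gp o (a (h ^+ n)%g o) (a (h ^+ n)%g (y N)).
  by rewrite gp_swap gp_shift -expVgn; have := HD n N; lra.
have := hyp.2 o _ _ _ _ h1 (HN N N (leqnn N) (leqnn N)).
by have := HC n N; lra.
Qed.

Lemma endpoints_exp o h alpha beta k : endpoints o h alpha beta ->
  endpoints o (h ^+ k.+1)%g alpha beta.
Proof.
move=> [ha hb ab]; have le n : (n <= k.+1 * n)%N by exact: leq_pmull.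
have powE g : (fun n => a (g ^+ n)%g o) \o (fun n => k.+1 * n)%N =
    (fun n => a ((g ^+ k.+1) ^+ n)%g o) by apply/funext => n /=; rewrite expgnA.
split=> //; first by rewrite -powE; exact: (rep_sub hyp le ha).
by rewrite -expVgn -powE; exact: (rep_sub hyp le hb).
Qed.

(** The element [w * h ^+ n] maps [o] close to [w alpha] and its inverse maps
    [o] close to [beta], so the orbit of [o] backtracks by a bounded amount and
    the translation length is the displacement up to a constant. *)
Lemma tl_mul_exp o w h alpha beta : endpoints o h alpha beta ->
  bd w alpha <> beta -> exists C, forall n,
  mdist (a (h ^+ n)%g o) o - C <= tl (w * h ^+ n)%g <= mdist (a (h ^+ n)%g o) o + C.
Proof.
move=> [ha hb _] wab.
have [C HC] := rep_bounded hyp o (act_rep w ha) hb wab.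
pose D := mdist (a w o) o; have D0 : 0 <= D := mdist_ge0 _ _.
exists (2 * C + 2 * delta + 4 * D) => n; have d0 := hyp.1.
have up := disp_mul a w (h ^+ n)%g o.
have lo := disp_mul a w^-1%g (w * h ^+ n)%g o; rewrite mulKg disp_inv in lo.
have C0 : 0 <= C by apply: le_trans (HC 0%N 0%N); exact: gp_ge0.
apply/andP; split; last by have := tl_le1 a o (w * h ^+ n)%g; rewrite -/D in up; lra.
have : gp o (a (w * h ^+ n)%g o) (a (w * h ^+ n)^-1%g o) <= C + D.
  have := gp_lip o (a (w * h ^+ n)%g o) (a (w * h ^+ n)^-1%g o) (a (h^-1 ^+ n)%g o).
  have := HC n n; rewrite invgM -expVgn !actM act_isometry disp_inv -/D; lra.
by move=> /(tl_lower hyp); rewrite -/D in lo; lra.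
Qed.

End Endpoints.

(** * Comparing two actions *)

Lemma nbhs_gboundaryP {R : realType} {X : metricType R} (o : X) (xi : gboundary X) A :
  nbhs xi A -> exists t, forall eta, ideal_nbhd o xi t (ideal eta) -> A eta.
Proof.
rewrite nbhsE => -[V [[U oU VE] Vxi] VA].
have Uxi : nbhs (ideal xi) U by apply: open_nbhs_nbhs; split=> //; rewrite -VE in Vxi.
have [t tU] := nbhs_idealP o Uxi.
by exists t => eta /tU; move=> Ueta; apply: VA; rewrite -VE.
Qed.

Section Transfer.
Context {R : realType} {G : groupType} {X Y : metricType R}.
Context (a : isometric_action G X) (b : isometric_action G Y).
Context (delta : R) (hypX : @thin R X delta) (epsilon : R) (hypY : @thin R Y epsilon).
Implicit Types (phi : gboundary X -> gboundary Y).
Local Notation gp := gromov_product.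

Definition equivariant_embedding phi : Prop :=
  [/\ {within limit_set a, continuous phi},
      forall g, {in limit_set a, forall xi, phi (boundary_act a g xi) = boundary_act b g (phi xi)} &
      {in limit_set a &, injective phi}].

Lemma phi_cont phi (o : X) (o' : Y) xi x y T : {within limit_set a, continuous phi} ->
  limit_set a xi -> sval xi x -> sval (phi xi) y ->
  exists t, forall eta u v, limit_set a eta -> sval eta u -> sval (phi eta) v ->
    prod_ge o x u t -> prod_ge o' y v T.
Proof.
move=> /subspace_continuousP cont lxi xix phiy.
have nb : nbhs (phi xi) [set zeta | ideal_nbhd o' (phi xi) (T + 2 * epsilon) (ideal zeta)].
  exact: (@initial_continuous _ _ (@ideal _ Y) (phi xi) _ (nbhs_ideal_nbhd hypY o' _ _)).
have [t Ht] := nbhs_gboundaryP o (cont xi lxi _ nb).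
exists t => eta u v leta etau phiv xu.
have h : ideal_nbhd o xi t (ideal eta) by apply/ideal_nbhdP; exists x, u.
by apply: prod_ge_le (ideal_nbhd_ideal hypY phiy phiv (Ht eta h leta)); lra.
Qed.

(** A convergent orbit sequence [g n o] pulls every limit point but at most one
    towards its limit: if [eta] is seen from [g n^-1 o] in a bounded Gromov
    product, then [g n eta] is close to [g n o]. So among three limit points two
    converge to [xi] under [g n]. Their images converge to [phi xi] by
    continuity, and drag along the orbit of [o'], which stays at bounded
    distance from the line joining the two image points moved by [g n]. *)
Lemma orbit_transfer phi (o : X) (o' : Y) xi (g : nat -> G) :
  equivariant_embedding phi -> three_points (limit_set a) ->
  sval xi (fun n => a (g n) o) -> sval (phi xi) (fun n => b (g n) o').
Proof.
move=> [cont equi inj] [e1 [e2 [e3 [[l1 l2 l3] [n12 n23 n13]]]]] gx.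
have lxi : limit_set a xi by apply/(limit_setP a hypX o); exists g.
have [x xix] := rep_nonempty xi; have [z xiz] := rep_nonempty (phi xi).
apply: (rep_of_nbhds hypY xiz) => T.
pose good C (y : nat -> X) n := forall j, gp o (y j) (a (g n)^-1%g o) <= C.
have pair C e e' y y' : limit_set a e -> limit_set a e' -> e <> e' ->
    sval e y -> sval e' y' -> exists N, forall n, (N <= n)%N ->
    good C y n -> good C y' n -> prod_ge o' z (cst (b (g n) o')) T.
  move=> le le' ee' ey ey'.
  have [v ev] := rep_nonempty (phi e); have [v' ev'] := rep_nonempty (phi e').
  have [K HK] : exists K, forall i j, gp o' (v i) (v' j) <= K.
    by apply: (rep_bounded hypY o' ev ev') => /inj E; apply: ee'; apply: E; rewrite inE.
  have [t Ht] := phi_cont o o' (T + 2 * epsilon + K) cont lxi xix xiz.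
  have [N HN] := orbit_rep_ge hypX (t + delta + `|C|) xix gx.
  have C0 := normr_ge0 C; have C1 := ler_norm C.
  have pulled n e0 y0 v0 : (N <= n)%N -> limit_set a e0 -> sval e0 y0 ->
      sval (phi e0) v0 -> good C y0 n ->
      prod_ge o' z (fun j => b (g n) (v0 j)) (T + 2 * epsilon + K).
    move=> Nn l0 ey0 ev0 gd; have [xg far] := HN n Nn.
    apply: (Ht (boundary_act a (g n) e0) (fun j => a (g n) (y0 j))).
    - exact: (limit_set_act hypX o).
    - exact: act_rep.
    - by rewrite equi ?inE //; exact: act_rep.
    have xg' : prod_ge o x (cst (a (g n) o)) (t + delta) by apply: prod_ge_le xg; lra.
    have gy : prod_ge o (cst (a (g n) o)) (fun j => a (g n) (y0 j)) (t + delta).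
      by exists 0%N => i j _ _ /=; rewrite gp_swap gp_shift gp_sym; have := gd j; lra.
    by apply: prod_ge_le (prod_ge_trans hypX _ xg' gy); lra.
  exists N => n Nn gd gd'.
  have h := pulled n e y v Nn le ey ev gd; have h' := pulled n e' y' v' Nn le' ey' ev' gd'.
  have [M HM] := prod_ge_trans hypY _ (prod_ge_sym h) h'.
  have near : prod_ge o' (fun j => b (g n) (v j)) (cst (b (g n) o')) (T + epsilon).
    exists M => i j Mi _; rewrite /= gp_sym.
    have := gp_side o' (b (g n) o') (b (g n) (v i)) (b (g n) (v' M)).
    by rewrite gromov_product_act; have := HM i M Mi (leqnn M); have := HK i M; lra.
  have h2 : prod_ge o' z (fun j => b (g n) (v j)) (T + epsilon).
    by apply: prod_ge_le h; have := hypY.1; have := HK 0%N 0%N;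
      have := gp_ge0 o' (v 0%N) (v' 0%N); lra.
  by apply: prod_ge_le (prod_ge_trans hypY _ h2 near); lra.
have goodW C C' y n : C <= C' -> good C y n -> good C' y n.
  by move=> CC' gd j; exact: le_trans (gd j) CC'.
have [y1 ey1] := rep_nonempty e1; have [y2 ey2] := rep_nonempty e2.
have [y3 ey3] := rep_nonempty e3.
have [C12 H12] := rep_bounded hypX o ey1 ey2 n12.
have [C13 H13] := rep_bounded hypX o ey1 ey3 n13.
have [C23 H23] := rep_bounded hypX o ey2 ey3 n23.
pose C := `|C12| + `|C13| + `|C23| + delta.
have [[p1 p2] p3] := (normr_ge0 C12, normr_ge0 C13, normr_ge0 C23).
have [[q1 q2] q3] := (ler_norm C12, ler_norm C13, ler_norm C23).
have W12 : C12 + delta <= C by rewrite /C; lra.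
have W13 : C13 + delta <= C by rewrite /C; lra.
have W23 : C23 + delta <= C by rewrite /C; lra.
have [N12 P12] := pair C _ _ _ _ l1 l2 n12 ey1 ey2.
have [N13 P13] := pair C _ _ _ _ l1 l3 n13 ey1 ey3.
have [N23 P23] := pair C _ _ _ _ l2 l3 n23 ey2 ey3.
exists (maxn N12 (maxn N13 N23)) => n; rewrite !geq_max => /and3P[h12 h13 h23].
have g12 : good C y1 n \/ good C y2 n.
  by case: (one_side_bounded hypX (a (g n)^-1%g o) H12) => /goodW h; [left | right]; exact: h.
have g13 : good C y1 n \/ good C y3 n.
  by case: (one_side_bounded hypX (a (g n)^-1%g o) H13) => /goodW h; [left | right]; exact: h.
have g23 : good C y2 n \/ good C y3 n.
  by case: (one_side_bounded hypX (a (g n)^-1%g o) H23) => /goodW h; [left | right]; exact: h.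
by case: g12 => ga; case: g13 => gb; case: g23 => gc; auto.
Qed.

Lemma endpoints_transfer phi (o : X) (o' : Y) h alpha beta :
  equivariant_embedding phi -> three_points (limit_set a) ->
  endpoints a o h alpha beta -> endpoints b o' h (phi alpha) (phi beta).
Proof.
move=> emb tri [ha hb ab]; have [_ _ inj] := emb.
split; [exact: (orbit_transfer o' emb tri ha) | exact: (orbit_transfer o' emb tri hb) |].
by move=> /inj E; apply: ab; apply: E; rewrite inE;
  [exact: (endpoint_limit hypX ha) | exact: (endpoint_limit hypX hb)].
Qed.

End Transfer.

(** * Roots of hyperbolic elements *)

Section Coordinate.
Context {R : realType} {X : metricType R} (delta : R) (hyp : @thin R X delta).
Implicit Types (o p q x y A B : X).
Local Notation gp := gromov_product.

Lemma four_point x y A B :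
  mdist x y + mdist A B <= mdist x A + mdist y B + 2 * delta \/
  mdist x y + mdist A B <= mdist x B + mdist y A + 2 * delta.
Proof.
have [h|/ltW h] := leP (gp A x B) (gp A B y).
  have := hyp.2 A x y B _ (lexx _) h.
  rewrite /gromov_product (metric_sym B A); right; lra.
have := hyp.2 A x y B _ h (lexx _).
rewrite /gromov_product (metric_sym B A) (metric_sym B y); left; lra.
Qed.

(** For [x] near a line from [A] to [B], this is the position of [x] along the
    line, up to an additive constant and a bounded error. *)
Definition coord A B x : R := (mdist x A - mdist x B) / 2.

Lemma coord_dist A B x y C : gp x A B <= C -> gp y A B <= C ->
  mdist x y <= `|coord A B x - coord A B y| + 2 * C + 2 * delta.
Proof.
have n1 := ler_norm (coord A B x - coord A B y).
have := ler_norm (- (coord A B x - coord A B y)); rewrite normrN => n2.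
move: n1 n2; rewrite /coord /gromov_product.
rewrite (metric_sym A x) (metric_sym B x) (metric_sym A y) (metric_sym B y).
by case: (four_point x y A B); lra.
Qed.

Lemma coord_lip A B x y : coord A B x - coord A B y <= mdist x y.
Proof.
have := metric_triangle x y A; have := metric_triangle y x B.
rewrite /coord (metric_sym y x); lra.
Qed.

(** Two far away points [A] and [A'] at bounded distance from each other define
    almost the same horofunction. *)
Lemma horofunction_near A A' x y :
  mdist x y + mdist A A' + 2 * delta < mdist x A + mdist y A' ->
  mdist x A - mdist y A <= mdist x A' - mdist y A' + 2 * delta.
Proof.
have := four_point x A y A'; rewrite (metric_sym A y) (metric_sym A A').
rewrite (metric_sym A' A).
by case; lra.
Qed.

End Coordinate.

Section Roots.
Context {R : realType} {G : groupType} {X : metricType R}.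
Context (a : isometric_action G X) (delta : R) (hyp : @thin R X delta).
Implicit Types (o p q x y : X) (v z : G).
Local Notation gp := gromov_product.

Local Notation orbit_coord v n o := (coord (a (v^-1 ^+ n)%g o) (a (v ^+ n)%g o)).

(** An isometry [z] commuting with [v] preserves the axis of [v] and acts on it
    almost as a translation, since it moves the far points of the orbit of [v]
    by a constant distance. *)
Lemma coord_commute v z o M C : commute v z ->
  (forall T, exists N, forall n, (N <= n)%N -> T <= mdist (a (v ^+ n)%g o) o) ->
  (forall n, gp o (a (v^-1 ^+ n)%g o) (a (v ^+ n)%g o) <= C) ->
  exists N, forall n, (N <= n)%N -> forall x y, mdist x o <= M -> mdist y o <= M ->
    [/\ orbit_coord v n o (a z x) - orbit_coord v n o (a z y) <=
          orbit_coord v n o x - orbit_coord v n o y + 2 * delta &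
        gp (a z x) (a (v^-1 ^+ n)%g o) (a (v ^+ n)%g o) <=
          gp x (a (v^-1 ^+ n)%g o) (a (v ^+ n)%g o) + 2 * delta].
Proof.
move=> vz far line; have d0 := hyp.1.
pose E := mdist (a z o) o; have E0 : 0 <= E := mdist_ge0 _ _.
have [N HN] := far (4 * `|M| + 4 * E + 4 * delta + 1 + `|C|).
have M1 := ler_norm M; have C1 := ler_norm C; have C0 := normr_ge0 C.
exists N => n /HN; set A := a (v^-1 ^+ n)%g o; set B := a (v ^+ n)%g o => dB x y xM yM.
pose A' := a z^-1%g A; pose B' := a z^-1%g B.
have dA : mdist A o = mdist B o by rewrite /A disp_expV.
have shift g : commute z g -> mdist (a g o) (a z^-1%g (a g o)) = E.
  by move=> zg; rewrite metric_sym act_inv_dist -actM zg actM act_isometry metric_sym.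
have AA' : mdist A A' = E.
  by apply: shift; rewrite expVgn; exact/commuteV/commuteX/commute_sym.
have BB' : mdist B B' = E by apply: shift; exact/commuteX/commute_sym.
have zA p : mdist (a z p) A = mdist p A' by rewrite (metric_sym p) act_inv_dist metric_sym.
have zB p : mdist (a z p) B = mdist p B' by rewrite (metric_sym p) act_inv_dist metric_sym.
have xy := metric_triangle x o y; rewrite (metric_sym o y) in xy.
have fA p : mdist p o <= M -> mdist A o - M <= mdist p A.
  by have := metric_triangle A p o; rewrite (metric_sym A p); lra.
have fB p : mdist p o <= M -> mdist B o - M <= mdist p B.
  by have := metric_triangle B p o; rewrite (metric_sym B p); lra.
have fA' p : mdist p o <= M -> mdist A o - M - E <= mdist p A'.
  move=> /fA; have := metric_triangle p A' A; rewrite (metric_sym A') AA'; lra.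
have fB' p : mdist p o <= M -> mdist B o - M - E <= mdist p B'.
  move=> /fB; have := metric_triangle p B' B; rewrite (metric_sym B') BB'; lra.
have [xA yA] := (fA x xM, fA y yM); have [xB yB] := (fB x xM, fB y yM).
have [xA' yA'] := (fA' x xM, fA' y yM); have [xB' yB'] := (fB' x xM, fB' y yM).
have M0 : 0 <= M := le_trans (mdist_ge0 _ _) xM.
split.
  rewrite /coord !zA !zB.
  have := horofunction_near hyp (A := A') (A' := A) (x := x) (y := y).
  have := horofunction_near hyp (A := B') (A' := B) (x := y) (y := x).
  by rewrite !(metric_sym _ A) !(metric_sym _ B) AA' BB' (metric_sym y x);
    rewrite !(metric_sym A) !(metric_sym B); lra.
have -> : gp (a z x) A B = gp x A' B'.
  by rewrite -(gromov_product_act a z x) !actKV.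
rewrite leNgt; apply/negP => big.
have gAB : gp x A B <= C + M.
  by have := gp_base x o A B; have := line n; rewrite -/A -/B; lra.
have gA : mdist B o - M - E <= gp x A A'.
  rewrite /gromov_product AA' (metric_sym A x) (metric_sym A' x); lra.
have gB : mdist B o - M - E <= gp x B' B.
  rewrite gp_sym /gromov_product BB' (metric_sym B x) (metric_sym B' x); lra.
pose e := Num.min (gp x A' B') (mdist B o - M - E).
have eg : gp x A B + 2 * delta < e by rewrite lt_min big /=; lra.
have e1 : e <= gp x A' B' by rewrite ge_min lexx.
have e2 : e <= mdist B o - M - E by rewrite ge_min lexx orbT.
have h1 := hyp.2 _ _ _ _ _ (le_trans e2 gA) e1.
have h2 : e - delta <= gp x B' B by lra.
by have := hyp.2 _ _ _ _ _ h1 h2; lra.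
Qed.

(** If [v = z ^+ m] with [2 <= m] and [p] is a path running along the axis of
    [v] from [o] to [v o], then [z] shifts [p]. In the coordinate along the
    axis, [z] is almost a translation, of length the [m]-th part of that of
    [v], hence at most half of it up to an error; so [z p i] is near [p (i + s)]
    for a constant [s]. *)
Lemma root_shift o v z m (p : nat -> X) N C :
  (z ^+ m.+2)%g = v -> delta <= C -> 20 * C < mdist (a v o) o -> p 0%N = o ->
  gp o (a v o) (a v^-1%g o) <= C ->
  (forall i, (i <= N)%N -> gp o (a v^-1%g o) (p i) <= C) ->
  (forall i, (i <= N)%N -> gp (p i) o (a v o) <= C) ->
  mdist (p N) (a v o) <= C ->
  (forall i, mdist (p i) (p i.+1) <= C) ->
  (forall i j, `|mdist (p (i + j)%N) o - mdist (p i) o - mdist (p j) o| <= 2 * C) ->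
  exists s, [/\ (s <= N)%N, mdist (p s) o <= mdist (a v o) o / 2 + 8 * C &
    forall i, (i + s <= N)%N -> mdist (a z (p i)) (p (i + s)%N) <= 36 * C].
Proof.
move=> zv dC; set L := mdist (a v o) o => CL p0 H1 H2 H3 H4 H5 H6.
have d0 := hyp.1.
have L2 : 2 * C + 2 * delta < L by lra.
have L3 : 2 * C + 3 * delta < L by lra.
have C0 : 0 < C by lra.
have Hfar T : exists N, forall n, (N <= n)%N -> T <= mdist (a (v ^+ n)%g o) o.
  have tl0 : 0 < translation_length a v by have := tl_lower hyp H1; rewrite -/L; lra.
  have [K HK] := nat_above (T / translation_length a v); exists K => n /HK.
  by rewrite ltr_pdivrMr // => h; have := tl_le a o v n; lra.
have Hline n : gp o (a (v^-1 ^+ n)%g o) (a (v ^+ n)%g o) <= 3 * C.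
  by rewrite gp_sym; have := orbit_line hyp H1 L3 n n; lra.
have Hpos n : L - 2 * C <= gp o (a v o) (a (v ^+ n.+1)%g o).
  by have := orbit_far hyp H1 L2 n; rewrite -/L; lra.
have Hneg n : L - 2 * C <= gp o (a v^-1%g o) (a (v^-1 ^+ n.+1)%g o).
  have H1' : gp o (a v^-1%g o) (a v^-1^-1%g o) <= C by rewrite invgK gp_sym.
  by have := orbit_far hyp H1' _ n; rewrite disp_inv -/L => /(_ L2); lra.
have pL i : (i <= N)%N -> mdist (p i) o <= L + C.
  move=> iN; have := gp_swap o (p i) (a v o); have := gp_le o (a v o) (p i).
  by rewrite gp_sym -/L; have := H3 i iN; lra.
have Hneg_p n i : (i <= N)%N -> gp o (a (v^-1 ^+ n.+1)%g o) (p i) <= 2 * C.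
  move=> iN; rewrite leNgt; apply/negP => big.
  pose e := Num.min (gp o (a (v^-1 ^+ n.+1)%g o) (p i)) (L - 2 * C).
  have eC : 2 * C < e by rewrite lt_min big /=; lra.
  have e1 : e <= gp o (a (v^-1 ^+ n.+1)%g o) (p i) by rewrite ge_min lexx.
  have e2 : e <= L - 2 * C by rewrite ge_min lexx orbT.
  have := hyp.2 _ _ _ _ _ (le_trans e2 (Hneg n)) e1.
  by have := H2 i iN; lra.
have Hpos_p n i : (i <= N)%N -> gp (p i) o (a (v ^+ n.+1)%g o) <= 4 * C.
  move=> iN; have h1 : mdist (p i) o - 3 * C <= gp o (p i) (a v o).
    by rewrite gp_swap; have := H3 i iN; lra.
  have h2 : mdist (p i) o - 3 * C <= gp o (a v o) (a (v ^+ n.+1)%g o).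
    by have := Hpos n; have := pL i iN; lra.
  have := hyp.2 _ _ _ _ _ h1 h2; rewrite (gp_swap o); lra.
have vz : commute v z by rewrite -zv; apply/commute_sym/commuteX.
pose M := L + C + m.+2%:R * mdist (a z o) o.
have m0 : 0 <= m.+2%:R * mdist (a z o) o by rewrite mulr_ge0 ?mdist_ge0.
have [K HK] := coord_commute M vz Hfar Hline.
have {HK} := HK K.+1 (leqnSn K).
set A := a (v^-1 ^+ K.+1)%g o; set B := a (v ^+ K.+1)%g o; set c := coord A B => HK.
have oM : mdist o o <= M by rewrite mdistxx /M; lra.
have pM i : (i <= N)%N -> mdist (p i) o <= M by move=> /pL; rewrite /M; lra.
have zM j : (j <= m.+2)%N -> mdist (a (z ^+ j)%g o) o <= M.
  move=> jm; apply: le_trans (disp_exp1 _ _ _ _) _.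
  have : j%:R * mdist (a z o) o <= m.+2%:R * mdist (a z o) o.
    by apply: ler_wpM2r; [exact: mdist_ge0 | rewrite ler_nat].
  by rewrite /M; lra.
have [t tE] : exists t, c (a z o) = c o + t by exists (c (a z o) - c o); lra.
have iter j : (j <= m.+2)%N ->
    j%:R * (t - 2 * delta) <= c (a (z ^+ j)%g o) - c o <= j%:R * (t + 2 * delta).
  elim: j => [|j IH] jm; first by rewrite expg0 act1 subrr !mul0r lexx.
  have /andP[h1 h2] := IH (ltnW jm).
  have [h3 _] := HK _ _ (zM j (ltnW jm)) oM; have [h4 _] := HK _ _ oM (zM j (ltnW jm)).
  rewrite expgS actM -natr1 !(mulrDl _ 1) !mul1r.
  by move: h3 h4; rewrite -/c tE => h3 h4; apply/andP; split; lra.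
have cp i : (i <= N)%N -> mdist (p i) o - 6 * C <= c (p i) - c o <= mdist (p i) o.
  move=> iN; rewrite coord_lip andbT.
  have := Hneg_p K i iN; have := Hpos_p K i iN; rewrite -/A -/B /c /coord /gromov_product.
  rewrite (metric_sym o (p i)) (metric_sym A o) (metric_sym A (p i)) (metric_sym B (p i)).
  lra.
have pgp i : (i <= N)%N -> gp (p i) A B <= 7 * C.
  move=> iN; have := Hpos_p K i iN; have := Hline K.+1; rewrite -/A -/B.
  have := metric_triangle A o (p i).
  rewrite /gromov_product (metric_sym o (p i)) (metric_sym o B); lra.
have /andP[t1 t2] := iter _ (leqnn m.+2).
have mm : (2 : R) <= m.+2%:R by rewrite ler_nat.
have cv : - (7 * C) <= c (a v o) - c o <= L.
  rewrite coord_lip andbT; have /andP[+ _] := cp N (leqnn N).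
  have := coord_lip A B (p N) (a v o); rewrite -/c; have := mdist_ge0 (p N) o; lra.
case/andP: cv => cv1 cv2; rewrite zv in t1 t2.
have tlo : - (6 * C) <= t.
  rewrite leNgt; apply/negP => tC.
  have : 0 <= (m.+2%:R - 2) * (- t - 2 * delta) by rewrite mulr_ge0 //; lra.
  lra.
have tup : t <= L / 2 + 2 * C.
  rewrite leNgt; apply/negP => tC.
  have : 0 <= (m.+2%:R - 2) * (t - 2 * delta) by rewrite mulr_ge0 //; lra.
  lra.
have [s [sN ts st]] : exists s, [/\ (s <= N)%N, t <= mdist (p s) o & mdist (p s) o <= t + 6 * C].
  have exN : exists s, t <= mdist (p s) o.
    exists N; have := metric_triangle (a v o) (p N) o; rewrite -/L.
    by rewrite (metric_sym (a v o) (p N)); lra.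
  have sN : (ex_minn exN <= N)%N.
    case: ex_minnP => s _ H; apply: H.
    have := metric_triangle (a v o) (p N) o; rewrite -/L (metric_sym (a v o) (p N)); lra.
  exists (ex_minn exN); split=> //; case: ex_minnP => [] // [|s] hs H.
    by rewrite p0 mdistxx; lra.
  have : mdist (p s) o < t by rewrite ltNge; apply/negP => /H; rewrite ltnn.
  have := metric_triangle (p s.+1) (p s) o; rewrite (metric_sym (p s.+1) (p s)).
  by have := H5 s; lra.
exists s; split=> //; first by lra.
move=> i isN; have iN := leq_trans (leq_addr s i) isN.
have [h1 g1] := HK _ _ (pM i iN) oM; have [h2 _] := HK _ _ oM (pM i iN).
have zgp : gp (a z (p i)) A B <= 9 * C by have := pgp i iN; lra.
have sgp : gp (p (i + s)%N) A B <= 9 * C by have := pgp _ isN; lra.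
apply: le_trans (coord_dist hyp zgp sgp) _.
suff : `|c (a z (p i)) - c (p (i + s)%N)| <= 16 * C by rewrite -/c; lra.
have := H6 i s; rewrite !ler_norml => /andP[q1 q2].
have /andP[] := cp i iN; have /andP[] := cp _ isN.
move: h1 h2; rewrite -/c tE => h1 h2 r1 r2 r3 r4.
by apply/andP; split; lra.
Qed.
End Roots.

(** * Primitive elements of proper actions *)

Lemma finite_set_pigeonhole (T : eqType) (A : set T) : finite_set A ->
  exists Q, forall e : nat -> T, (forall i, (i <= Q)%N -> A (e i)) ->
  exists i d, (i + d.+1 <= Q)%N /\ e i = e (i + d.+1)%N.
Proof.
move=> /finite_seqP[s As]; exists (size s) => e eA; apply: contrapT => H.
have : uniq (map e (iota 0 (size s).+1)).
  rewrite map_inj_in_uniq ?iota_uniq // => i j; rewrite !mem_iota /= !add0n !ltnS.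
  wlog ij : i j / (i <= j)%N => [W|] iQ jQ E.
    by case/orP: (leq_total i j) => h; [exact: W | apply: esym; exact: W].
  move: ij; rewrite leq_eqVlt => /orP[/eqP //|ij]; exfalso; apply: H.
  by exists i, (j - i.+1)%N; rewrite addnS -addSn subnKC.
have sub : {subset map e (iota 0 (size s).+1) <= s}.
  by move=> x /mapP[i]; rewrite mem_iota /= add0n ltnS => /eA; rewrite As => ? ->.
by move=> /uniq_leq_size/(_ sub); rewrite size_map size_iota ltnn.
Qed.

Section Primitive.
Context {R : realType} {G : groupType} {X : metricType R}.
Context (a : isometric_action G X) (delta : R) (hyp : @thin R X delta).
Implicit Types (o : X) (h k w v z : G).
Local Notation gp := gromov_product.

Lemma primitive_of_no_root u :
  (forall z m, (z ^+ m.+2)%g <> u^-1%g) -> @primitive_elt G u.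
Proof.
move=> nr h [[|[|n]]|[|n]] //= hn E.
  by apply: (nr h^-1%g n); rewrite expVgn E.
by apply: (nr h n); rewrite E invgK.
Qed.

(** If [z ^+ m = (w * k ^+ N)^-1] with [2 <= m], then [z] shifts the path
    [o, k^-1 o, k^-2 o, ...], which runs along most of the axis of [z], by a constant
    number [s] of steps. So the elements [k ^+ (i + s) * z * k ^- i] move [o]
    by a bounded distance; when [N] is large there are more such [i] than there
    are such elements in a proper action, two of them coincide, and a power of [k]
    commutes with [z], hence with [w], which must then preserve the fixed
    points of [k]. *)
Lemma mul_exp_primitive o k w alpha beta : proper_action a ->
  endpoints a o k alpha beta ->
  boundary_act a w alpha <> alpha -> boundary_act a w alpha <> beta ->
  exists N0, forall N, (N0 <= N)%N -> primitive_elt (w * k ^+ N)%g.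
Proof.
move=> prop E wa wb; have [ka kb ab] := E; have d0 := hyp.1.
have [K1 HK1] := rep_bounded hyp o ka kb ab.
have [K2 HK2] := rep_bounded hyp o (act_rep a w ka) kb wb.
have K10 : 0 <= K1 by apply: le_trans (HK1 0%N 0%N); exact: gp_ge0.
have K20 : 0 <= K2 by apply: le_trans (HK2 0%N 0%N); exact: gp_ge0.
pose C := K1 + K2 + mdist (a w o) o + mdist (a k o) o + delta.
have Dw := mdist_ge0 (a w o) o; have Dk := mdist_ge0 (a k o) o.
have C0 : 0 < 36 * C by rewrite /C; lra.
have [Q HQ] := finite_set_pigeonhole (prop _ o C0).
pose f n := mdist (a (k ^+ n)%g o) o.
have [N0 HN0] := rep_disp hyp (2 * (Q%:R * C) + 50 * C) ka.
exists N0 => N /HN0; rewrite -/(f N) => fN.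
apply: primitive_of_no_root => z m zv.
set v := ((w * k ^+ N)^-1)%g in zv.
have vE : v = (k^-1 ^+ N * w^-1)%g by rewrite /v invgM expVgn.
pose p i := a (k^-1 ^+ i)%g o.
have pf i : mdist (p i) o = f i by rewrite /p disp_expV.
have QC : 0 <= Q%:R * C by rewrite mulr_ge0 //; lra.
have wv x : mdist (a (k^-1 ^+ x)%g (a w^-1%g o)) (p x) = mdist (a w o) o.
  by rewrite act_isometry disp_inv.
have vo : a v o = a (k^-1 ^+ N)%g (a w^-1%g o) by rewrite vE actM.
have voi : a v^-1%g o = a w (a (k ^+ N)%g o) by rewrite /v invgK actM.
have gpw (q r : X) x : gp q r (a (k^-1 ^+ x)%g (a w^-1%g o)) <= gp q r (p x) + mdist (a w o) o.
  by have := gp_lip q r (a (k^-1 ^+ x)%g (a w^-1%g o)) (p x); rewrite wv; lra.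
have pshift i y : gp (p i) o y = gp o (a (k ^+ i)%g o) (a (k ^+ i)%g y).
  by rewrite -(gromov_product_act a (k ^+ i)%g) /p expVgn actKV.
have fadd i j : `|f (i + j)%N - f i - f j| <= 2 * C.
  have h1 := HK1 i j; have h2 := gp_ge0 o (a (k ^+ i)%g o) (p j).
  have : f (i + j)%N = f i + f j - 2 * gp o (a (k ^+ i)%g o) (p j).
    rewrite /gromov_product pf -/(f i) /p expVgn metric_sym act_inv_dist.
    by rewrite (metric_sym o) -actM -expgnDr addnC -/(f _); lra.
  by rewrite -/(p j) in h1; rewrite ler_norml => ->; apply/andP; rewrite /C; split; lra.
have fle i : f i <= i%:R * C.
  apply: le_trans (disp_exp1 a k o i) _; apply: ler_wpM2l => //; rewrite /C; lra.
have vL : f N - C <= mdist (a v o) o.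
  have := disp_mul a w^-1%g (w * k ^+ N)%g o; rewrite mulKg disp_inv -/(f N) disp_inv /C; lra.
have vU : mdist (a v o) o <= f N + C.
  by rewrite disp_inv; have := disp_mul a w (k ^+ N)%g o; rewrite -/(f N) /C; lra.
have [|||||||||s [sN fs Hs]] := @root_shift _ _ _ a _ hyp o v z m p N C zv.
- by rewrite /C; lra.
- lra.
- by rewrite /p expg0 act1.
- rewrite gp_sym voi vo; have := gpw o (a w (a (k ^+ N)%g o)) N.
  by have := HK2 N N; rewrite -/(p N) /C; lra.
- by move=> i iN; rewrite voi; have := HK2 N i; rewrite -/(p i) /C; lra.
- move=> i iN; rewrite pshift vo.
  have -> : a (k ^+ i)%g (a (k^-1 ^+ N)%g (a w^-1%g o)) = a (k^-1 ^+ (N - i))%g (a w^-1%g o).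
    by rewrite -{1}(subnKC iN) expgnDr actM expVgn actKV.
  by have := gpw o (a (k ^+ i)%g o) (N - i)%N; have := HK1 i (N - i)%N; rewrite -/(p _) /C; lra.
- by rewrite vo metric_sym wv /C; lra.
- move=> i; rewrite /p expgSr actM act_isometry metric_sym disp_inv /C; lra.
- by move=> i j; rewrite !pf; exact: fadd.
(* The first [s] steps of the path cover about half of its length at most, so
   at least [Q] steps remain. *)
have QN : (Q + s <= N)%N.
  rewrite leqNgt; apply/negP => NQ.
  have h1 : f (N - s)%N <= Q%:R * C.
    apply: le_trans (fle _) _; apply: ler_wpM2r; first by lra.
    by rewrite ler_nat leq_subLR addnC ltnW.
  have := fadd s (N - s)%N; rewrite subnKC // ler_norml => /andP[_].
  by rewrite pf in fs; lra.
pose e i := (k ^+ (i + s) * z * k^-1 ^+ i)%g.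
have eF i : (i <= Q)%N -> [set g | mdist (a g o) o <= 36 * C] (e i).
  move=> iQ /=; have := Hs i (leq_trans (leq_add iQ (leqnn s)) QN).
  by rewrite /e !actM /p -(act_isometry a (k ^+ (i + s))%g) (expVgn k (i + s)) actKV.
have [i [d [_ eE]]] := HQ e eF.
have kz : commute (k ^+ d.+1)%g z.
  have e2 : e (i + d.+1)%N = (k ^+ (i + s) * (k ^+ d.+1 * z * k^-1 ^+ d.+1) * k^-1 ^+ i)%g.
    by rewrite /e addnAC (addnC i d.+1) (expgnDr k (i + s)) (expgnDr k^-1%g d.+1) !mulgA.
  move: eE; rewrite e2 /e => /mulIg/mulgI zE.
  by rewrite /commute {2}zE -!mulgA expVgn mulVg mulg1.
have kw : commute (k ^+ d.+1)%g w.
  have kv : commute (k ^+ d.+1)%g v by rewrite -zv; exact: (commuteX _ kz).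
  have -> : w = (v^-1 * k^-1 ^+ N)%g by rewrite /v invgK expVgn mulgK.
  by rewrite expVgn; exact: (commuteM (commuteV kv) (commuteV (commuteX2 _ _ (commute_refl k)))).
have [kda _ _] := endpoints_exp hyp d E.
have : boundary_act a (k ^+ d.+1)%g (boundary_act a w alpha) = boundary_act a w alpha.
  by rewrite -(bdM a hyp) kw (bdM a hyp) (endpoint_fixed hyp kda).
by case/(fixed_endpoint hyp (endpoints_exp hyp d E)).
Qed.

End Primitive.

(** * Elements moving a given boundary point *)

Section OneAction.
Context {R : realType} {G : groupType} {X : metricType R}.
Context (a : isometric_action G X) (delta : R) (hyp : @thin R X delta).
Implicit Types (o : X) (g h : G) (xi alpha beta : gboundary X).
Local Notation gp := gromov_product.
Local Notation tl := (translation_length a).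
Local Notation bd := (boundary_act a).
Local Notation general_type := (non_elementary a \/ quasi_parabolic a).

Lemma endpoints_fixed o h al be : endpoints a o h al be -> bd h al = al /\ bd h be = be.
Proof.
move=> E; have [ea _ _] := E; have [eb _ _] := endpoints_inv E.
split; first exact: (endpoint_fixed hyp ea).
apply: (bd_inj hyp (a := a) (g := h^-1%g)).
by rewrite (bdK a hyp) (endpoint_fixed hyp eb).
Qed.

Lemma limit_set_three (o : X) : general_type -> three_points (limit_set a).
Proof.
move=> [[g [h [hg hh gh]]]|[_ _ //]].
have [al [be E]] := hyperbolic_endpoints hyp o hg.
have [ga [ep F]] := hyperbolic_endpoints hyp o hh.
have [ea eb ab] := E; have [fg _ _] := F.
have fix_ne eta : bd g eta = eta -> eta <> ga.
  move=> h1 h2; have : (boundary_fix a g `&` boundary_fix a h) ga.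
    by split; [rewrite /boundary_fix /= -h2 | exact: (endpoint_fixed hyp fg)].
  by rewrite gh.
have [gal gbe] := endpoints_fixed E.
exists al, be, ga; split; split=> //.
- exact: (endpoint_limit hyp ea).
- exact: (endpoint_limit hyp eb).
- exact: (endpoint_limit hyp fg).
- exact: fix_ne.
- exact: fix_ne.
Qed.

(** In the quasi-parabolic case, a hyperbolic element fixing [xi] fixes only [xi]
    and the global fixed point, so its conjugate by an element that moves [xi]
    does not fix [xi]. *)
Lemma moving_hyperbolic (o : X) xi : general_type -> (exists g, bd g xi <> xi) ->
  exists2 h, 0 < tl h & bd h xi <> xi.
Proof.
move=> [[g [h [hg hh gh]]] _|[[h hh] [om [omf _]] _] [g gxi]].
  apply: contrapT => H; suff : (boundary_fix a g `&` boundary_fix a h) xi by rewrite gh.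
  by split; apply: contrapT => K; apply: H; [exists g | exists h].
have [hxi|hxi] := pselect (bd h xi = xi); last by exists h.
exists (g * h * g^-1)%g; first exact: lt_le_trans (tl_conj_ge a o g h).
rewrite !(bdM a hyp) => E.
have hgxi : bd h (bd g^-1%g xi) = bd g^-1%g xi by rewrite -{2}E (bdK a hyp).
(* [h] would fix the three distinct points [om], [xi] and [g^-1 xi]. *)
have n1 : xi <> om by move=> xo; apply: gxi; rewrite xo omf.
have n2 : bd g^-1%g xi <> om.
  by move=> xo; apply: n1; rewrite -(omf g) -xo (bdKV a hyp).
have n3 : bd g^-1%g xi <> xi by move=> xo; apply: gxi; rewrite -{1}xo (bdKV a hyp).
have [al [be F]] := hyperbolic_endpoints hyp o hh.
have := fixed_endpoint hyp F hxi; have := fixed_endpoint hyp F (omf h).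
have := fixed_endpoint hyp F hgxi.
by move=> [e1|e1] [e2|e2] [e3|e3]; congruence.
Qed.

(** The rays [h ^+ n o] and [g (h ^+ n o)] are asymptotic, so the elements
    [h ^- n * g * h ^+ n] move [o] by a bounded distance. By properness two of
    them coincide: [g] commutes with a power of [h], and preserves its
    endpoints. *)
Lemma proper_fixed_endpoint o h g al be : proper_action a -> endpoints a o h al be ->
  bd g al = al -> bd g be = be.
Proof.
move=> prop E gal; apply: contrapT => gbe; have [ea eb ab] := E; have d0 := hyp.1.
have [K HK] := rep_bounded hyp o ea eb ab.
have K0 : 0 <= K by apply: le_trans (HK 0%N 0%N); exact: gp_ge0.
pose D := mdist (a g o) o; have D0 : 0 <= D := mdist_ge0 _ _.
pose r := 2 * (K + D + 2 * delta) + D; have r0 : 0 < r by rewrite /r; lra.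
have [Q HQ] := finite_set_pigeonhole (prop r o r0).
pose f n := mdist (a (h ^+ n)%g o) o.
have eP n : (n <= Q)%N -> [set u | mdist (a u o) o <= r] (h^-1 ^+ n * g * h ^+ n)%g.
  move=> _ /=; rewrite !actM expVgn act_inv_dist.
  have gea := act_rep a g ea; rewrite gal in gea.
  have [N HN] := rep_ge hyp gea ea o (f n).
  pose m := (n + N)%N.
  have h1 : f n - K <= gp o (a (h ^+ m)%g o) (a (h ^+ n)%g o).
    rewrite gp_sym gp_swap -/(f n) /m expgnDr actM gp_shift gp_sym -expVgn.
    by have := HK N n; lra.
  have h2 : f n - K - D <= gp o (a g (a (h ^+ n)%g o)) (a g (a (h ^+ m)%g o)).
    rewrite gp_sym; have := gp_base (a g o) o (a g (a (h ^+ m)%g o)) (a g (a (h ^+ n)%g o)).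
    by rewrite gromov_product_act -/D; lra.
  have h3 := HN m m (leq_addl n N) (leq_addl n N).
  have h4 : f n - K - D <= gp o (a g (a (h ^+ m)%g o)) (a (h ^+ m)%g o) by lra.
  have h5 := hyp.2 _ _ _ _ _ h2 h4.
  have h6 : f n - K - D - delta <= gp o (a (h ^+ m)%g o) (a (h ^+ n)%g o) by lra.
  have := hyp.2 _ _ _ _ _ h5 h6; rewrite /gromov_product -/(f n).
  have := metric_triangle (a g (a (h ^+ n)%g o)) (a g o) o.
  by rewrite act_isometry -/(f n) -/D /r; lra.
have [i [d [_ eE]]] := HQ _ eP.
have hg : commute (h ^+ d.+1)%g g.
  move: eE; rewrite (addnC i) (expgnDr h) addnC expgnDr -!mulgA => /mulgI.
  rewrite !mulgA => /mulIg gE.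
  by rewrite /commute {1}gE !mulgA expVgn mulgV mul1g.
have Ed := endpoints_exp hyp d E; have [_ hbe] := endpoints_fixed Ed.
have : bd (h ^+ d.+1)%g (bd g be) = bd g be by rewrite -(bdM a hyp) hg (bdM a hyp) hbe.
case/(fixed_endpoint hyp Ed) => // gb; apply: ab; apply: (bd_inj hyp (a := a) (g := g)).
by rewrite gal gb.
Qed.

(** A global fixed point is an endpoint of a hyperbolic element, whose other
    endpoint is then a global fixed point as well by [proper_fixed_endpoint];
    but a quasi-parabolic action has only one. *)
Lemma proper_moves (o : X) xi : general_type -> proper_action a -> exists g, bd g xi <> xi.
Proof.
move=> typ prop; apply: contrapT => /forallNP xif.
have {}xif g : bd g xi = xi by apply: contrapT; exact: xif.
case: typ => [[g [h [_ _ gh]]]|[[h hh] [om [omf omu]] _]].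
  suff : (boundary_fix a g `&` boundary_fix a h) xi by rewrite gh.
  by split; exact: xif.
have absurd k al be : endpoints a o k al be -> xi = al -> False.
  move=> E xa; have [_ _ ab] := E; apply: ab.
  rewrite -(omu al); last by move=> g; rewrite -xa.
  by apply: omu => g; apply: (proper_fixed_endpoint prop E); rewrite -xa.
have [al [be E]] := hyperbolic_endpoints hyp o hh.
by case: (fixed_endpoint hyp E (xif h));
  [exact: (absurd _ _ _ E) | exact: (absurd _ _ _ (endpoints_inv E))].
Qed.

(** If [g alpha = beta], then [g (g alpha)] is neither point: [g] moves [beta],
    and the fixed points of [g ^+ 2] are those of [g]. *)
Lemma escape (o : X) g al be : 0 < tl g -> bd g al <> al -> al <> be ->
  exists w, bd w al <> al /\ bd w al <> be.
Proof.
move=> hg gal ab; have [gb|gb] := pselect (bd g al = be); last by exists g.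
exists (g ^+ 2)%g; split.
  have [ga [ep F]] := hyperbolic_endpoints hyp o hg; have [fga fep] := endpoints_fixed F.
  by move=> /(fixed_endpoint hyp (endpoints_exp hyp 1 F))[] E; apply: gal; rewrite E.
rewrite expgS expg1 (bdM a hyp) gb -{2}gb => /(bd_inj hyp); exact: nesym.
Qed.

End OneAction.

(** * Long elements in two comparable actions *)

Lemma comparable_embeddings {R : realType} {G : groupType} {X Y : metricType R}
    (a : isometric_action G X) (b : isometric_action G Y) (o : X) :
  gromov_hyperbolic X -> comparable_actions a b ->
  exists phi psi, [/\ equivariant_embedding a b phi, equivariant_embedding b a psi &
    forall xi, limit_set b xi -> limit_set a (psi xi) /\ phi (psi xi) = xi].
Proof.
move=> /gromov_hyperbolic_thin[delta hyp].
move=> [phi [psi [[fp fq pq qp] [cp cq ep]]]].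
exists phi, psi; split.
- by split=> //; exact: can_in_inj pq.
- split=> //; last exact: can_in_inj qp.
  move=> g eta; rewrite inE => leta.
  have lp : limit_set a (psi eta) := fq _ leta.
  rewrite -{1}(qp eta) ?inE // -ep ?inE // pq // inE.
  exact: (limit_set_act hyp o).
- by move=> eta leta; split; [exact: fq | apply: qp; rewrite inE].
Qed.

Section TwoActions.
Context {R : realType} {G : groupType} {X Y : metricType R}.
Context (a : isometric_action G X) (b : isometric_action G Y).
Context (delta : R) (hypX : @thin R X delta) (epsilon : R) (hypY : @thin R Y epsilon).
Context (phi : gboundary X -> gboundary Y) (psi : gboundary Y -> gboundary X).
Context (emb_phi : equivariant_embedding a b phi) (emb_psi : equivariant_embedding b a psi).
Context (phiK : forall xi, limit_set b xi -> limit_set a (psi xi) /\ phi (psi xi) = xi).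
Context (typeX : non_elementary a \/ quasi_parabolic a).
Context (typeY : non_elementary b \/ quasi_parabolic b).
Context (o : X) (o' : Y).
Implicit Types (g h k w : G) (alpha beta xi : gboundary X) (T : R).
Local Notation gp := gromov_product.
Local Notation tla := (translation_length a).
Local Notation tlb := (translation_length b).

Definition common_endpoints k alpha beta : Prop :=
  endpoints a o k alpha beta /\ endpoints b o' k (phi alpha) (phi beta).

Lemma common_endpoints_inv k alpha beta :
  common_endpoints k alpha beta -> common_endpoints k^-1%g beta alpha.
Proof. by case=> E F; split; exact: endpoints_inv. Qed.

Lemma hyperbolic_common k : 0 < tla k \/ 0 < tlb k ->
  exists alpha beta, common_endpoints k alpha beta.
Proof.
case=> [/(hyperbolic_endpoints hypX o)|/(hyperbolic_endpoints hypY o')] [al [be E]].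
  exists al, be; split=> //.
  exact: (endpoints_transfer hypX hypY o' emb_phi (limit_set_three hypX o typeX) E).
have [ea eb _] := E.
have [la Ea] := phiK (endpoint_limit hypY ea); have [lb Eb] := phiK (endpoint_limit hypY eb).
exists (psi al), (psi be); split; last by rewrite Ea Eb.
exact: (endpoints_transfer hypY hypX o emb_psi (limit_set_three hypY o' typeY) E).
Qed.

Lemma mul_exp_both w k alpha beta : common_endpoints k alpha beta ->
  boundary_act a w alpha <> beta -> exists C, forall n,
  (mdist (a (k ^+ n)%g o) o - C <= tla (w * k ^+ n)%g <= mdist (a (k ^+ n)%g o) o + C) /\
  (mdist (b (k ^+ n)%g o') o' - C <= tlb (w * k ^+ n)%g <= mdist (b (k ^+ n)%g o') o' + C).
Proof.
move=> [E F] wab; have [ea eb _] := E; have [_ equi inj] := emb_phi.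
have la := endpoint_limit hypX ea; have lb := endpoint_limit hypX eb.
have [C HC] := tl_mul_exp hypX E wab.
have [|D HD] := tl_mul_exp hypY F (w := w).
  rewrite -equi ?inE // => /inj H; apply: wab; apply: H; rewrite inE //.
  exact: (limit_set_act hypX o).
exists (`|C| + `|D|) => n.
have := ler_norm C; have := ler_norm D; have := normr_ge0 C; have := normr_ge0 D.
move=> D0 C0 D1 C1; have /andP[h1 h2] := HC n; have /andP[h3 h4] := HD n.
by split; apply/andP; split; lra.
Qed.

Lemma both_large w k alpha beta T : common_endpoints k alpha beta ->
  boundary_act a w alpha <> beta -> exists N, forall n, (N <= n)%N ->
  T < tla (w * k ^+ n)%g /\ T < tlb (w * k ^+ n)%g.
Proof.
move=> cE wab; have [[ea _ _] [fa _ _]] := cE; have [C HC] := mul_exp_both cE wab.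
have [N HN] := rep_disp hypX (T + C + 1) ea; have [M HM] := rep_disp hypY (T + C + 1) fa.
exists (maxn N M) => n; rewrite geq_max => /andP[/HN h1 /HM h2].
by have [/andP[h3 _] /andP[h4 _]] := HC n; split; lra.
Qed.

(** If the two lengths of [k] differ, so do those of [w * k ^+ n] for
    arbitrarily large [n], since these grow like [n] times those of [k]. *)
Lemma mul_exp_distinguishes w k alpha beta : common_endpoints k alpha beta ->
  boundary_act a w alpha <> beta -> tla k <> tlb k ->
  forall N, exists2 n, (N <= n)%N & tla (w * k ^+ n)%g <> tlb (w * k ^+ n)%g.
Proof.
move=> cE wab ne N; have [C HC] := mul_exp_both cE wab.
apply: contrapT => H; apply: ne.
have eqN n : (N <= n)%N -> tla (w * k ^+ n)%g = tlb (w * k ^+ n)%g.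
  by move=> Nn; apply: contrapT => K; apply: H; exists n.
apply/eqP; rewrite eq_le; apply/andP; split.
  apply: (linear_le (K := 2 * C) (tl_approx b o' k)) => n.
  exists (maxn n N); rewrite ?leq_maxl //; have := eqN _ (leq_maxr n N).
  have := tl_le a o k (maxn n N).
  by have [/andP[h1 h2] /andP[h3 h4]] := HC (maxn n N); lra.
apply: (linear_le (K := 2 * C) (tl_approx a o k)) => n.
exists (maxn n N); rewrite ?leq_maxl //; have := eqN _ (leq_maxr n N).
have := tl_le b o' k (maxn n N).
by have [/andP[h1 h2] /andP[h3 h4]] := HC (maxn n N); lra.
Qed.

(** The element is [w * k ^+ n], where [w] is chosen so as to make it primitive
    if the action is proper, and [w = 1] otherwise. *)
Lemma long_distinguishing_element T k : tla k <> tlb k -> exists e,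
  [/\ tla e <> tlb e, T < tla e, T < tlb e & proper_action a -> primitive_elt e].
Proof.
move=> ne; have pos : 0 < tla k \/ 0 < tlb k.
  have := tl_ge0 a o k; have := tl_ge0 b o' k; rewrite !le_eqVlt.
  by move=> /orP[/eqP kb|->] /orP[/eqP ka|->]; auto; case: ne; rewrite -ka -kb.
have [al [be cE]] := hyperbolic_common pos; have [E F] := cE; have [ea eb ab] := E.
have [prop|nprop] := pselect (proper_action a).
  have [h hh hal] := moving_hyperbolic hypX o typeX (proper_moves hypX o al typeX prop).
  have [w [wa wb]] := escape hypX o hh hal ab.
  have [N HN] := both_large T cE wb; have [M HM] := mul_exp_primitive hypX prop E wa wb.
  have [n] := mul_exp_distinguishes cE wb ne (maxn N M).
  rewrite geq_max => /andP[/HN[h1 h2] /HM h3] h4.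
  by exists (w * k ^+ n)%g.
have wb : boundary_act a 1%g al <> be by rewrite (bd1 a hypX).
have [N HN] := both_large T cE wb; have [n /HN[h1 h2] h4] := mul_exp_distinguishes cE wb ne N.
by exists (1 * k ^+ n)%g.
Qed.

(** Let [g o] be close to [xi], while [g^-1 o] and [alpha] are not close to each
    other as seen from [o]. Then [g] maps the points [k ^+ j o] close to [g o]:
    these points and their limit [g alpha] are close to [xi], so [g alpha] is
    not one of the endpoints of [k]. *)
Lemma element_near x k alpha beta xi g K T : common_endpoints k alpha beta ->
  sval xi x -> 0 <= T -> 0 <= K ->
  (forall i j, gp o (x i) (a (k ^+ j)%g o) <= K) ->
  (forall i j, gp o (x i) (a (k^-1 ^+ j)%g o) <= K) ->
  (forall j, gp o (a (k ^+ j)%g o) (a g^-1%g o) <= K + delta) ->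
  prod_ge o x (cst (a g o)) (T + 2 * K + 10 * delta) ->
  T + 2 * K + 10 * delta <= mdist (a g o) o ->
  exists e, [/\ prod_ge o x (cst (a e o)) T, T < tla e, T < tlb e &
    proper_action a -> primitive_elt e].
Proof.
move=> cE xix T0 K0 xk xk' kg xg far; have [E _] := cE; have [ea eb ab] := E.
have d0 := hypX.1.
have gk : prod_ge o (cst (a g o)) (fun j => a g (a (k ^+ j)%g o)) (T + K + 9 * delta).
  by exists 0%N => i j _ _ /=; rewrite gp_swap gp_shift gp_sym; have := kg j; lra.
have xgk : prod_ge o x (fun j => a g (a (k ^+ j)%g o)) (T + K + 8 * delta).
  have xg' : prod_ge o x (cst (a g o)) (T + K + 9 * delta) by apply: prod_ge_le xg; lra.
  by apply: prod_ge_le (prod_ge_trans hypX _ xg' gk); lra.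
have away eta y : sval eta y -> (forall i j, gp o (x i) (y j) <= K) ->
    boundary_act a g alpha <> eta.
  move=> ey xy E'; have gea := act_rep a g ea; rewrite E' in gea.
  have [N HN] := prod_ge_trans hypX _ xgk (rep_ge hypX gea ey o _).
  by have := HN N N (leqnn N) (leqnn N); have := xy N N; lra.
have wa := away _ _ ea xk; have wb := away _ _ eb xk'.
have [N1 HN1] := both_large T cE wb.
have [N2 HN2] : exists N, forall n, (N <= n)%N -> proper_action a -> primitive_elt (g * k ^+ n)%g.
  have [prop|nprop] := pselect (proper_action a); last by exists 0%N.
  by have [M HM] := mul_exp_primitive hypX prop E wa wb; exists M => n /HM.
have [N3 HN3] := xgk; pose n := maxn N1 (maxn N2 N3).
exists (g * k ^+ n)%g.
have [h1 h2] := HN1 n (leq_maxl _ _).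
split=> //; last by apply: HN2; rewrite /n leq_max leq_maxl orbT.
apply/prod_ge_cstP; exists N3 => i Ni; rewrite actM.
by have := HN3 i n Ni; rewrite /n !leq_max leqnn !orbT => /(_ isT); lra.
Qed.

Lemma long_elements_near x xi T : limit_set a xi -> sval xi x ->
  exists e, [/\ prod_ge o x (cst (a e o)) T, T < tla e, T < tlb e &
    proper_action a -> primitive_elt e].
Proof.
move=> lxi xix; have d0 := hypX.1.
have [mov|fix_] := pselect (exists g, boundary_act a g xi <> xi).
  have [h hh hxi] := moving_hyperbolic hypX o typeX mov.
  have [al [be cE]] := hyperbolic_common (or_introl hh); have [E _] := cE.
  have [ea eb ab] := E; have [hal hbe] := endpoints_fixed hypX E.
  have [K1 HK1] : exists C, forall i j, gp o (x i) (a (h ^+ j)%g o) <= C.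
    by apply: (rep_bounded hypX o xix ea) => xa; apply: hxi; rewrite xa.
  have [K2 HK2] : exists C, forall i j, gp o (x i) (a (h^-1 ^+ j)%g o) <= C.
    by apply: (rep_bounded hypX o xix eb) => xa; apply: hxi; rewrite xa.
  have [K3 HK3] := rep_bounded hypX o ea eb ab.
  pose K : R := `|K1| + `|K2| + `|K3|.
  have [n1 n2 n3] := And3 (normr_ge0 K1) (normr_ge0 K2) (normr_ge0 K3).
  have [m1 m2 m3] := And3 (ler_norm K1) (ler_norm K2) (ler_norm K3).
  have K0 : 0 <= K by rewrite /K; lra.
  have B1 i j : gp o (x i) (a (h ^+ j)%g o) <= K by have := HK1 i j; rewrite /K; lra.
  have B2 i j : gp o (x i) (a (h^-1 ^+ j)%g o) <= K by have := HK2 i j; rewrite /K; lra.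
  have B3 i j : gp o (a (h ^+ i)%g o) (a (h^-1 ^+ j)%g o) <= K.
    by have := HK3 i j; rewrite /K; lra.
  have [g gx] := (limit_setP a hypX o xi).1 lxi.
  have [N HN] := orbit_rep_ge hypX (`|T| + 2 * K + 10 * delta) xix gx.
  have [xg far] := HN N (leqnn N); have T0 := normr_ge0 T; have T1 := ler_norm T.
  suff [e [e1 e2 e3 e4]] : exists e, [/\ prod_ge o x (cst (a e o)) `|T|, `|T| < tla e,
      `|T| < tlb e & proper_action a -> primitive_elt e].
    by exists e; split=> //;
      [exact: prod_ge_le e1 | exact: le_lt_trans e2 | exact: le_lt_trans e3].
  case: (one_side_bounded hypX (a (g N)^-1%g o) B3) => side.
    exact: (element_near cE xix T0 K0 B1 B2 side xg far).
  apply: (element_near (common_endpoints_inv cE) xix T0 K0 B2 _ side xg far).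
  by rewrite invgK.
have xif g : boundary_act a g xi = xi by apply: contrapT => H; apply: fix_; exists g.
have nprop : ~ proper_action a.
  by move=> prop; have [g] := proper_moves hypX o xi typeX prop.
have [h hh] : exists h, 0 < tla h.
  by case: typeX => [[h [_ [hh _ _]]]|[[h hh] _ _]]; exists h.
have [al [be cE]] := hyperbolic_common (or_introl hh).
suff near k al' be' : common_endpoints k al' be' -> xi = al' -> exists e,
    [/\ prod_ge o x (cst (a e o)) T, T < tla e, T < tlb e & proper_action a -> primitive_elt e].
  have [E _] := cE; case: (fixed_endpoint hypX E (xif h)); first exact: near cE.
  exact: near (common_endpoints_inv cE).
move=> cE' xa; have [[ea _ ab] _] := cE'; rewrite -xa in ea ab.
have wb : boundary_act a 1%g al' <> be' by rewrite (bd1 a hypX) -xa.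
have [N HN] := both_large T cE' wb; have [M HM] := orbit_rep_ge hypX T xix ea.
exists (k ^+ maxn N M)%g.
have [h1 h2] := HN _ (leq_maxl N M); have [h3 _] := HM _ (leq_maxr N M).
by rewrite mul1g in h1 h2; split.
Qed.

End TwoActions.

(** * The sparse set *)

Lemma counting_le_size {R : realType} (T : choiceType) (A : set T) (s : seq T) :
  A `<=` [set` s] -> (counting A <= (size s)%:R%:E :> \bar R)%E.
Proof.
move=> As; have fA : finite_set A by apply: sub_finite_set As (finite_seq s).
rewrite /counting asboolT // lee_fin ler_nat.
apply: uniq_leq_size; first exact: finmap.fset_uniq.
by move=> x; rewrite in_fset_set // => /set_mem /As.
Qed.

(** If [m] is the last index with [l (e m) <= T], at most [m.+1] terms are
    counted, and [m.+1 <= f T] since [T] exceeds [s m]. *)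
Lemma sparse_range {R : realType} (H : choiceType) (f : R -> R) (s : nat -> R)
    (e : nat -> H) (l : H -> R) T :
  (forall t, 0 < f t) -> (forall n, n%:R <= s n) ->
  (forall n t, s n <= t -> n.+1%:R <= f t) -> (forall n, s n < l (e n)) ->
  (counting [set g | range e g /\ (l g <= T)%R] <= (f T)%:E)%E.
Proof.
move=> f0 ns sf sl.
have small n : l (e n) <= T -> s n <= T by move=> h; apply: ltW; exact: lt_le_trans h.
have [some|none] := pselect (exists n, l (e n) <= T); last first.
  apply: (@le_trans _ _ (0%:R)%:E); last by rewrite lee_fin ltW.
  by apply: (counting_le_size (s := [::])) => _ [[n _ <-] h]; case: none; exists n.
have [N HN] := nat_above T.
have bnd n : l (e n) <= T -> (n <= N)%N.
  move=> /small snT; rewrite leqNgt; apply/negP => /ltnW /HN.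
  by have := ns n; lra.
case: (ex_maxnP some bnd) => m hm mmax.
apply: (@le_trans _ _ (m.+1%:R)%:E); last by rewrite lee_fin; apply: sf; exact: small.
rewrite -[m.+1](size_iota 0) -(size_map e); apply: counting_le_size => _ [[n _ <-] h].
by apply: map_f; rewrite mem_iota /= add0n ltnS; exact: mmax.
Qed.

Unset Implicit Arguments.

Theorem theorem2 (R : realType) (f : R -> R)
    (f_gt0 : forall T : R, 0 < f T)
    (f_infty : f T @[T --> +oo] --> +oo)
    (G : groupType) (X Y : metricType R)
    (hypX : gromov_hyperbolic X) (hypY : gromov_hyperbolic Y)
    (ntX : three_points [set: gboundary X])
    (ntY : three_points [set: gboundary Y])
    (a : isometric_action G X) (b : isometric_action G Y)
    (typeX : non_elementary a \/ quasi_parabolic a)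
    (typeY : non_elementary b \/ quasi_parabolic b)
    (cmp : comparable_actions a b)
    (xi : gboundary X) (xi_lim : limit_set a xi) :
  exists E : set G,
    [/\ (forall g, E g -> translation_length a g = translation_length b g) ->
          forall g, translation_length a g = translation_length b g,
        forall T : R,
          (counting [set g | E g /\ (translation_length a g <= T)%R]
             <= (f T)%:E)%E /\
          (counting [set g | E g /\ (translation_length b g <= T)%R]
             <= (f T)%:E)%E,
        accumulation_points a E = [set xi] &
        proper_action a -> forall g, E g -> primitive_elt g].
Proof.
have [delta thinX] := gromov_hyperbolic_thin hypX.
have [epsilon thinY] := gromov_hyperbolic_thin hypY.
have [x xix] := rep_nonempty xi; pose o := x 0%N.
have [phi [psi [emb_phi emb_psi phiK]]] := comparable_embeddings o hypX cmp.
have [y phixy] := rep_nonempty (phi xi); pose o' := y 0%N.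
have thr (n : nat) : exists s : R, n%:R <= s /\ forall t, s <= t -> n.+1%:R <= f t.
  move/cvgryPge : f_infty => /(_ n.+1%:R)[M [_ HM]].
  exists (Num.max (M + 1) n%:R); split; first by rewrite le_max lexx orbT.
  move=> t; rewrite ge_max => /andP[Mt _]; apply: HM => /=.
  by apply: lt_le_trans Mt; rewrite ltrDl.
have [s Hs] := choice thr.
have near n := long_elements_near thinX thinY emb_phi emb_psi phiK typeX typeY
  o o' (s n) xi_lim xix.
have [e He] := choice near.
have [e0 [e00 e0a e0b e0p]] : exists e0, [/\
    (exists g, translation_length a g <> translation_length b g) ->
    translation_length a e0 <> translation_length b e0,
    s 0%N < translation_length a e0, s 0%N < translation_length b e0 &
    proper_action a -> primitive_elt e0].
  have [[g ne]|eq] := pselect (exists g, translation_length a g <> translation_length b g).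
    have [e0 [h1 h2 h3 h4]] := long_distinguishing_element thinX thinY emb_phi emb_psi
      phiK typeX typeY o o' (s 0%N) ne.
    by exists e0.
  by have [_ h2 h3 h4] := He 0%N; exists (e 0%N).
pose u n := if n is 0 then e0 else e n.
have ua n : s n < translation_length a (u n) by case: n => [//|n]; have [] := He n.+1.
have ub n : s n < translation_length b (u n) by case: n => [//|n]; have [] := He n.+1.
exists (range u); split.
- move=> eqE g; apply: contrapT => ne; apply: (e00 (ex_intro _ g ne)).
  by apply: eqE; exists 0%N.
- move=> T; split; [apply: (sparse_range _ f_gt0 _ _ ua) | apply: (sparse_range _ f_gt0 _ _ ub)];
    move=> n; by have [] := Hs n.
- apply: (accumulation_points_range thinX (o := o)); apply: (rep_of_nbhds thinX xix) => T.
  have [N HN] := nat_above T; exists N.+1 => -[//|n] /ltnW Nn /=.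
  have [h _ _ _] := He n.+1; apply: prod_ge_le h.
  by apply: le_trans (Hs n.+1).1; exact/ltW/HN.
- by move=> prop _ [[|n] _ <-] /=; [exact: e0p | have [_ _ _] := He n.+1; exact].
Qed.
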